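(* Let $d,m\in\mathbb{N}$, let $\mathcal{X}\subseteq\mathbb{R}^d$ be a bounded domain, $\mathcal{Y}=\{-1,1\}$, $\mathcal{Z}=\mathcal{X}\times\mathcal{Y}$, and let $\rho$ be a probability distribution on $\mathcal{Z}$. Let ${\bf z}=\{z_i=(x_i,y_i): i=1,\dots,m\}$ be drawn i.i.d. from $\rho$. Fix a margin $r>0$, a regularization parameter $\lambda>0$, and a matrix norm $\|\cdot\|$ on $d\times d$ matrices. For a symmetric matrix $A\in\mathbb{S}^{d\times d}$ let $K_A(x,x')=x^TAx'$, $$\mathcal{E}_{\bf z}(A)=\frac1m\sum_{i=1}^m\Big(1-\frac{1}{mr}\sum_{j=1}^m y_iy_jK_A(x_i,x_j)\Big)_+,\qquad \mathcal{E}(A)=\int_{\mathcal{Z}}\Big(1-\frac1r\int_{\mathcal{Z}}yy'K_A(x,x')\,d\rho(x',y')\Big)_+d\rho(x,y),$$ and let $A_{\bf z}\in\arg\min_{A\in\mathbb{S}^{d\times d}}\big[\mathcal{E}_{\bf z}(A)+\lambda\|A\|\big]$. Then for any $0<\delta<1$, with probability at least $1-\delta$ over ${\bf z}$, $$\mathcal{E}_{\bf z}(A_{\bf z})-\mathcal{E}(A_{\bf z})\le \frac{6\mathcal{R}_m}{r\lambda}+\frac{2X_*}{r\lambda}\sqrt{\frac{2\ln(1/\delta)}{m}},$$ where $X_*=\sup_{x,x'\in\mathcal{X}}\|x'x^T\|_*$ and $\mathcal{R}_m=\mathbb{E}_{{\bf z},\sigma}\Big[\sup_{\tilde x\in\mathcal{X}}\Big\|\frac1m\sum_{i=1}^m\sigma_iy_ix_i\tilde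 x^T\Big\|_*\Big]$.
   Context: $(t)_+=\max(t,0)$. The dual norm of a matrix norm $\|\cdot\|$ is $\|B\|_*=\sup_{\|A\|\le1}\mathrm{trace}(B^TA)$. In $\mathcal{R}_m$, $\sigma_1,\dots,\sigma_m$ are i.i.d. Rademacher variables ($P(\sigma_i=1)=P(\sigma_i=-1)=1/2$) independent of ${\bf z}$, and the expectation is over both ${\bf z}$ and $\sigma$. $\mathbb{S}^{d\times d}$ denotes the symmetric $d\times d$ real matrices. *)

(* Defs.v *)
From HB Require Import structures.
From mathcomp Require Import all_boot all_order all_algebra.
From mathcomp Require Import all_classical all_reals all_analysis.
Set Implicit Arguments. Unset Strict Implicit. Unset Printing Implicit Defensive.
Import Order.TTheory GRing.Theory Num.Theory.
Import numFieldNormedType.Exports.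
Local Open Scope classical_set_scope.
Local Open Scope ring_scope.

(* Data space Z: a point z = (x, y) with x in R^d encoded as a d-tuple of reals
   (product Borel sigma-algebra) and a real label y (supported on {-1,1}). *)
Definition Zdat (R : realType) (d : nat) := (d.-tuple R * R)%type.

Definition vec (R : realType) (d : nat) (t : d.-tuple R) : 'cV[R]_d :=
  \col_i tnth t i.

Definition zx (R : realType) (d : nat) (z : Zdat R d) : 'cV[R]_d := vec z.1.
Definition zy (R : realType) (d : nat) (z : Zdat R d) : R := z.2.

Definition pos_part (R : realType) (t : R) : R := Num.max t 0.

Definition symmx (R : realType) (d : nat) (A : 'M[R]_d) : Prop := A^T = A.

Definition is_matrix_norm (R : realType) (d : nat) (N : 'M[R]_d -> R) : Prop :=
  [/\ forall A, N A = 0 -> A = 0,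
      forall (a : R) A, N (a *: A) = `|a| * N A &
      forall A B, N (A + B) <= N A + N B].

Definition dualnorm (R : realType) (d : nat) (N : 'M[R]_d -> R) (B : 'M[R]_d) : R :=
  sup [set \tr (B^T *m A) | A in [set A : 'M[R]_d | N A <= 1]].

Definition KA (R : realType) (d : nat) (A : 'M[R]_d) (x x' : 'cV[R]_d) : R :=
  (x^T *m A *m x') ord0 ord0.

Definition emp_err (R : realType) (d m : nat) (r : R) (zs : 'I_m -> Zdat R d)
    (A : 'M[R]_d) : R :=
  m%:R^-1 * \sum_(i < m) pos_part (1 - (m%:R * r)^-1 *
     \sum_(j < m) zy (zs i) * zy (zs j) * KA A (zx (zs i)) (zx (zs j))).

Definition exp_err (R : realType) (d : nat) (rho : probability (Zdat R d) R)
    (r : R) (A : 'M[R]_d) : R :=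
  Rintegral rho setT (fun z => pos_part (1 - r^-1 *
     Rintegral rho setT (fun z' => zy z * zy z' * KA A (zx z) (zx z')))).

Definition rsign {R : realType} (b : bool) : R := if b then 1 else -1.

Definition Xstar (R : realType) (d : nat) (N : 'M[R]_d -> R) (X : set 'cV[R]_d) : R :=
  sup [set t | exists x x', X x /\ X x' /\ t = dualnorm N (x' *m x^T)].

(* Rademacher average R_m = E_{z,sigma}[ sup_{xt in X} || 1/m sum_i sigma_i y_i x_i xt^T ||_* ],
   where the sample z is (Zs 1, ..., Zs m) on (Omega, P), and the expectation over
   the i.i.d. uniform signs sigma (independent of z) is the average over all 2^m
   sign vectors. *)
Definition rademacher (R : realType) (d m : nat) (N : 'M[R]_d -> R) (X : set 'cV[R]_d)
    (dO : measure_display) (Omega : measurableType dO) (P : probability Omega R)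
    (Zs : 'I_m -> Omega -> Zdat R d) : R :=
  Rintegral P setT (fun w =>
    (2 ^+ m)%:R^-1 * \sum_(s : {ffun 'I_m -> bool})
      sup [set dualnorm N (\sum_(i < m)
              ((m%:R^-1 * rsign (s i) * zy (Zs i w)) *: (zx (Zs i w) *m xt^T)))
          | xt in X]).

Definition iid_sample (R : realType) (d m : nat) (rho : probability (Zdat R d) R)
    (dO : measure_display) (Omega : measurableType dO) (P : probability Omega R)
    (Zs : 'I_m -> Omega -> Zdat R d) : Prop :=
  [/\ forall i, measurable_fun setT (Zs i),
      forall i (B : set (Zdat R d)), measurable B -> P (Zs i @^-1` B) = rho B &
      forall B : 'I_m -> set (Zdat R d), (forall i, measurable (B i)) ->
        P (\bigcap_(i in [set: 'I_m]) (Zs i @^-1` B i)) =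
        (\prod_(i < m) P (Zs i @^-1` B i))%E].

(* Main.v *)
(** Write [u = y x], let [mu] be the mean of [u], [phi t = (1 - t / r)_+], and let
    [H v] be the supremum over [x] in [X] of [||v x^T||_*], so that
    [|v^T A x| <= ||A|| H v].  Comparing with [A = 0] gives [||A_z|| <= 1 / lam].
    Replacing the empirical mean of the [u_i] by [mu] inside [phi] bounds
    [E_z(A) - E(A)], uniformly over [||A|| <= 1 / lam], by the statistic
    [H(mean u_i - mu) / (r lam) + sup_a (mean phi(u_i . a) - E phi(u . a))], where [a]
    ranges over the vectors with [|v . a| <= H v / lam] (such as [A mu]).  This statistic
    has bounded differences [4 X_* / (m r lam)], and by symmetrization of both terms and
    contraction for the second its mean is at most [4 R_m / (r lam)]; McDiarmid's
    inequality concludes.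

    No product measure is needed: the data space is partitioned into finitely many cells
    of diameter at most [e], each represented by a point of [X] or [-X], and the
    probabilistic argument runs over finite sums.  Letting [e] tend to [0], the event of
    the theorem is the limit superior of the events obtained for [e = 1 / (n + 1)]. *)

Require Import Defs.
From HB Require Import structures.
From mathcomp Require Import all_boot all_order all_algebra.
From mathcomp Require Import all_classical all_reals all_analysis.
From mathcomp Require Import measurable_realfun ring lra.
Set Implicit Arguments. Unset Strict Implicit. Unset Printing Implicit Defensive.
Import Order.TTheory GRing.Theory Num.Theory.
Import numFieldNormedType.Exports.
Local Open Scope classical_set_scope.
Local Open Scope ring_scope.

(** * Hoeffding's lemma *)

(** Equivalent to [tanh (k / 2) <= k / 2]. The auxiliary [f] is nondecreasing on the nonnegative
    reals because [(1 - x) e^x <= 1]. *)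
Lemma expR_sub1_le (R : realType) (k : R) : 0 <= k ->
  expR k - 1 <= k / 2 * (expR k + 1).
Proof.
move=> k0.
pose f (x : R) : R := x * (expR x + 1) - 2 * expR x.
have df (x : R) : is_derive x 1 f (1 - expR x + x * expR x).
  by apply: is_derive_eq; rewrite /GRing.scale /=; ring.
have cf : continuous f.
  by move=> x; apply/differentiable_continuous/derivable1_diffP.
have : f 0 <= f k.
  apply: (@ger0_derive1_ndecry _ f 0) => // [x|x].
  - rewrite in_itv/= andbT => x0; rewrite derive1E (@derive_val _ _ _ _ _ _ _ (df x)).
    have := expR_ge1Dx (- x); rewrite expRN => h.
    have : (1 - x) * expR x <= 1.
      by rewrite -ler_pdivlMr ?expR_gt0// div1r.
    by lra.
  - exact: continuous_subspaceT.
rewrite /f mul0r expR0; lra.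
Qed.

(** The left side is the moment generating function of a Bernoulli variable of mean [t]. Its
    quotient [f] by the right side is nonincreasing: the sign of the derivative is settled by
    [expR_sub1_le] at [x / 2] and a perfect square. *)
Lemma bernoulli_mgf_le (R : realType) (t h : R) : 0 <= t <= 1 -> 0 <= h ->
  1 - t + t * expR h <= expR (t * h + h ^+ 2 / 8).
Proof.
move=> /andP[t0 t1] h0.
pose f (x : R) : R := (1 - t + t * expR x) * expR (- (t * x + x ^+ 2 / 8)).
pose df (x : R) : R := (t * (1 - t) * (expR x - 1) - x / 4 * (1 - t + t * expR x)) *
  expR (- (t * x + x ^+ 2 / 8)).
have dfE (x : R) : is_derive x 1 f (df x).
  have d1 : is_derive x 1 (fun y : R => - (t * y + y ^+ 2 / 8)) (- (t + x / 4)).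
    by apply: is_derive_eq; rewrite /GRing.scale /=; field.
  have d2 := is_derive1_comp (is_derive_expR _) d1.
  by apply: is_derive_eq; rewrite /df /GRing.scale /=; field.
have cf : continuous f.
  by move=> y; apply/differentiable_continuous/derivable1_diffP.
have : f h <= f 0.
  apply: (@ler0_derive1_nincry _ f 0) => // [x|x].
  - rewrite in_itv/= andbT => x0; rewrite derive1E (@derive_val _ _ _ _ _ _ _ (dfE x)).
    rewrite /df pmulr_lle0 ?expR_gt0//.
    have /expR_sub1_le : 0 <= x / 2 by lra.
    have -> : expR x = expR (x / 2) ^+ 2 by rewrite expr2 -expRD -splitr.
    set E := expR (x / 2) => hE.
    have E1 : 1 <= E by rewrite -expR0 ler_expR; lra.
    have : t * (1 - t) * (E + 1) * (E - 1) <= t * (1 - t) * (E + 1) * (x / 2 / 2 * (E + 1)).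
      by apply: ler_wpM2l => //; rewrite !mulr_ge0//; lra.
    (* the slack left by AM-GM in [t (1 - t) (E + 1)^2 <= 1 - t + t E^2] *)
    have : 0 <= x / 4 * (t * E - (1 - t)) ^+ 2 by rewrite mulr_ge0 ?sqr_ge0//; lra.
    nra.
  - exact: continuous_subspaceT.
have -> : f 0 = 1.
  by rewrite /f expR0 mulr0 expr0n/= mul0r addr0 oppr0 expR0; ring.
by rewrite /f expRN ler_pdivrMr ?expR_gt0// mul1r.
Qed.

Section FiniteExpectation.
Context {R : realType} {T : finType} (p : T -> R).
Hypothesis p_ge0 : forall t, 0 <= p t.
Hypothesis p_sum1 : \sum_t p t = 1.

(** With [a] the minimum of [g], one has [g = a + c th] with [th] in [[0, 1]]. Bounding the
    exponential by its chord reduces the claim to a Bernoulli variable of mean [q]. *)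
Lemma hoeffding_lemma (c s : R) (g : T -> R) : 0 < c -> 0 <= s ->
  (forall t t', g t - g t' <= c) ->
  \sum_t p t * expR (s * g t) <=
    expR (s * (\sum_t p t * g t) + s ^+ 2 * c ^+ 2 / 8).
Proof.
move=> c0 s0 gc.
have [t0 _] : exists t0 : T, true.
  case: (pickP (@predT T)) => [t0 _|h]; first by exists t0.
  by move: p_sum1; rewrite big_pred0// => /eqP; rewrite eq_sym oner_eq0.
have [tm _ tmin] := arg_minP g (isT : xpredT t0).
set a := g tm; pose th t := (g t - a) / c.
have th01 t : 0 <= th t <= 1.
  rewrite divr_ge0 ?subr_ge0 ?tmin ?(ltW c0)//=.
  by rewrite ler_pdivrMr// mul1r gc.
have gE t : g t = a + th t * c by rewrite /th divfK ?gt_eqF//; lra.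
have cvx t : expR (s * g t) <= expR (s * a) * (1 - th t + th t * expR (s * c)).
  have /andP[h0 h1] := th01 t.
  have := @convex_expR R (Itv01 h0 h1) (s * a + s * c) (s * a).
  rewrite !convRE /=.
  have -> : th t * (s * a + s * c) + unstable.onem (th t) * (s * a) = s * g t.
    by rewrite gE /unstable.onem; ring.
  by move=> /le_trans; apply; rewrite expRD /unstable.onem le_eqVlt; apply/orP; left; apply/eqP; ring.
pose q := \sum_t p t * th t.
have q01 : 0 <= q <= 1.
  rewrite sumr_ge0/= => [|t _]; last by rewrite mulr_ge0//; have /andP[] := th01 t.
  rewrite -p_sum1; apply: ler_sum => t _; rewrite ler_piMr//.
  by have /andP[] := th01 t.
have Eg : \sum_t p t * g t = a + q * c.
  rewrite (eq_bigr (fun t => p t * a + p t * th t * c)); last first.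
    by move=> t _; rewrite gE mulrDr mulrA.
  by rewrite big_split/= -!mulr_suml p_sum1 mul1r.
apply: (@le_trans _ _ (expR (s * a) * (1 - q + q * expR (s * c)))).
  apply: (@le_trans _ _ (\sum_t p t * (expR (s * a) * (1 - th t + th t * expR (s * c))))).
    by apply: ler_sum => t _; rewrite ler_wpM2l.
  rewrite (eq_bigr (fun t => expR (s * a) * (p t + p t * th t * (expR (s * c) - 1)))); last first.
    by move=> t _; ring.
  rewrite -mulr_sumr big_split/= -mulr_suml p_sum1 -/q.
  by apply: ler_wpM2l; [exact: expR_ge0|lra].
have sc0 : 0 <= s * c by rewrite mulr_ge0// ltW.
have := bernoulli_mgf_le q01 sc0.
move/(ler_wpM2l (expR_ge0 (s * a))) => /le_trans; apply.
rewrite -expRD ler_expR Eg; lra.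
Qed.

End FiniteExpectation.

(** * Bounded differences and symmetrization over a finite alphabet *)

Section FfunCons.
Context {T : finType} {n : nat}.

(** Splitting off the first coordinate allows induction on the sample size. *)
Definition fcons (x : T) (g : {ffun 'I_n -> T}) : {ffun 'I_n.+1 -> T} :=
  [ffun i => oapp g x (unlift ord0 i)].

Lemma fcons0 x g : fcons x g ord0 = x.
Proof. by rewrite ffunE unlift_none. Qed.

Lemma fconsS x g i : fcons x g (lift ord0 i) = g i.
Proof. by rewrite ffunE liftK. Qed.

Lemma sum_ffunS (V : nmodType) (F : {ffun 'I_n.+1 -> T} -> V) :
  \sum_f F f = \sum_x \sum_g F (fcons x g).
Proof.
rewrite pair_big /= (reindex (fun xg => fcons xg.1 xg.2)) //=.
exists (fun f => (f ord0, [ffun i => f (lift ord0 i)])) => [[x g] _|f _] /=.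
  by rewrite fcons0; congr pair; apply/ffunP => i; rewrite ffunE fconsS.
apply/ffunP => i; case: (unliftP ord0 i) => [j|] ->; last by rewrite fcons0.
by rewrite fconsS ffunE.
Qed.

End FfunCons.

Lemma sum_ffun0 (T : finType) (V : nmodType) (F : {ffun 'I_0 -> T} -> V) :
  exists f0, \sum_f F f = F f0.
Proof.
have f0P : #|'I_0| = 0%N by rewrite card_ord.
exists (ffun0 f0P); rewrite (big_pred1 (ffun0 f0P)) // => f /=.
by apply/esym/eqP/ffunP => -[].
Qed.

(** Mass function of the [n]-fold product law. *)
Definition pweight {R : realType} {T : finType} (p : T -> R) {n}
  (f : {ffun 'I_n -> T}) : R := \prod_i p (f i).

(** The one-sided bound is equivalent to the two-sided one, since [f] and [g] may be exchanged. *)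
Definition bounded_diff {R : realType} {T : finType} {n} (c : R)
    (F : {ffun 'I_n -> T} -> R) :=
  forall (f g : {ffun 'I_n -> T}) k,
    (forall i, i != k -> f i = g i) -> F f - F g <= c.

Section ProductWeights.
Context {R : realType} {T : finType} (p : T -> R).
Hypothesis p_ge0 : forall t, 0 <= p t.
Hypothesis p_sum1 : \sum_t p t = 1.

Lemma pweight_ge0 n (f : {ffun 'I_n -> T}) : 0 <= pweight p f.
Proof. by apply: prodr_ge0. Qed.

Lemma pweight_cons n x (g : {ffun 'I_n -> T}) :
  pweight p (fcons x g) = p x * pweight p g.
Proof.
rewrite /pweight big_ord_recl fcons0; congr (_ * _).
by apply: eq_bigr => i _; rewrite fconsS.
Qed.

Lemma pweight_sum1 n : \sum_(f : {ffun 'I_n -> T}) pweight p f = 1.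
Proof. by rewrite /pweight -(bigA_distr_bigA (fun=> p)) big1. Qed.

Lemma pweight_sum_cons n (F : {ffun 'I_n.+1 -> T} -> R) :
  \sum_f pweight p f * F f =
  \sum_g pweight p g * \sum_x p x * F (fcons x g).
Proof.
rewrite sum_ffunS exchange_big; apply: eq_bigr => g _; rewrite mulr_sumr.
by apply: eq_bigr => x _; rewrite pweight_cons; ring.
Qed.

(** Induction on [n] in place of a martingale argument: averaging out the first coordinate gives
    [G], which still has bounded differences, and Hoeffding's lemma in that coordinate costs one
    factor [exp (s^2 c^2 / 8)]. *)
Lemma mcdiarmid_mgf n (c s : R) (F : {ffun 'I_n -> T} -> R) : 0 < c -> 0 <= s ->
  bounded_diff c F ->
  \sum_f pweight p f * expR (s * F f) <=
    expR (s * (\sum_f pweight p f * F f) + n%:R * (s ^+ 2 * c ^+ 2 / 8)).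
Proof.
move=> c0 s0; elim: n F => [|n IHn] F bF.
  have [f0 E] := sum_ffun0 (fun f => pweight p f * expR (s * F f)).
  have [f1 E1] := sum_ffun0 (fun f => pweight p f * F f).
  rewrite E E1 /pweight !big_ord0 !mul1r mul0r addr0.
  by rewrite (_ : f0 = f1) //; apply/ffunP => -[].
rewrite !pweight_sum_cons.
pose G (g : {ffun 'I_n -> T}) := \sum_x p x * F (fcons x g).
have bG : bounded_diff c G.
  move=> f g k fg; rewrite /G -sumrB -[leRHS]mul1r -p_sum1 mulr_suml.
  apply: ler_sum => x _; rewrite -mulrBr ler_wpM2l//.
  apply: (bF _ _ (lift ord0 k)) => i.
  case: (unliftP ord0 i) => [j|] ->; last by rewrite !fcons0.
  by rewrite (inj_eq (@lift_inj _ ord0)) !fconsS => /fg.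
pose K := s ^+ 2 * c ^+ 2 / 8.
apply: (@le_trans _ _ (\sum_g pweight p g * (expR (s * G g) * expR K))).
  apply: ler_sum => g _; rewrite ler_wpM2l ?pweight_ge0// -expRD.
  apply: hoeffding_lemma => // t t'; apply: (bF _ _ ord0) => i.
  by case: (unliftP ord0 i) => [j|] ->; rewrite ?eqxx// !fconsS.
under eq_bigr do rewrite mulrA.
rewrite -mulr_suml -/K.
rewrite (_ : _ + _ = (s * (\sum_g pweight p g * G g) + n%:R * K) + K); last first.
  by rewrite -natr1; ring.
by rewrite expRD ler_wpM2r ?expR_ge0// IHn.
Qed.

Lemma mcdiarmid n (c e : R) (F : {ffun 'I_n -> T} -> R) : (0 < n)%N -> 0 < c -> 0 <= e ->
  bounded_diff c F ->
  \sum_(f | \sum_g pweight p g * F g + e <= F f) pweight p f <=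
    expR (- (2 * e ^+ 2 / (n%:R * c ^+ 2))).
Proof.
move=> n0 c0 e0 bF.
have nR : 0 < n%:R :> R by rewrite ltr0n.
(* This value minimizes the Chernoff exponent [- s e + n s^2 c^2 / 8]. *)
pose s : R := 4 * e / (n%:R * c ^+ 2).
have s0 : 0 <= s by rewrite divr_ge0// mulr_ge0// ?sqr_ge0.
set EF := \sum_g _.
have : \sum_(f | EF + e <= F f) pweight p f * expR (s * (EF + e)) <=
    expR (s * EF + n%:R * (s ^+ 2 * c ^+ 2 / 8)).
  apply: le_trans (mcdiarmid_mgf _ s0 bF) => //.
  rewrite [leRHS](bigID (fun f => EF + e <= F f)) /=.
  rewrite -[leLHS]addr0 lerD//; last first.
    by apply: sumr_ge0 => f _; rewrite mulr_ge0 ?pweight_ge0 ?expR_ge0.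
  apply: ler_sum => f h; rewrite ler_wpM2l ?pweight_ge0// ler_expR.
  by rewrite ler_wpM2l.
rewrite -mulr_suml -ler_pdivlMr ?expR_gt0// -expRN -expRD => /le_trans; apply.
rewrite ler_expR le_eqVlt; apply/orP; left; apply/eqP; rewrite /s.
by field; rewrite !gt_eqF.
Qed.

(** * Symmetrization of sublinear functionals *)

Lemma sublinear_jensen (V : lmodType R) (Psi : V -> R) (I : finType) (q : I -> R) (v : I -> V) :
  (forall u w, Psi (u + w) <= Psi u + Psi w) ->
  (forall (a : R) u, 0 <= a -> Psi (a *: u) = a * Psi u) ->
  (forall i, 0 <= q i) ->
  Psi (\sum_i q i *: v i) <= \sum_i q i * Psi (v i).
Proof.
move=> PD PZ q0.
have P0 : Psi 0 = 0 by rewrite -[X in Psi X](scale0r 0) PZ// mul0r.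
elim/big_rec2 : _ => [|i y x _ h]; first by rewrite P0.
by rewrite (le_trans (PD _ _))// PZ// lerD2l.
Qed.

Lemma expect_sum_coord n (V : lmodType R) (e : T -> V) :
  \sum_(f : {ffun 'I_n -> T}) pweight p f *: (\sum_i e (f i)) =
  n%:R *: \sum_t p t *: e t.
Proof.
elim: n => [|n IHn].
  by rewrite scale0r big1// => f _; rewrite big_ord0 scaler0.
rewrite sum_ffunS.
rewrite (eq_bigr (fun x => p x *: e x + p x *: (n%:R *: \sum_t p t *: e t))).
  by rewrite big_split/= -scaler_suml p_sum1 scale1r -natr1 scalerDl scale1r addrC.
move=> x _; rewrite -IHn.
rewrite (eq_bigr (fun g => pweight p g *: (p x *: e x) +
   p x *: (pweight p g *: (\sum_i e (g i))))).
  by rewrite big_split/= -scaler_suml pweight_sum1 scale1r scaler_sumr.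
move=> g _; rewrite pweight_cons big_ord_recl fcons0 scalerDr -!scalerA; congr (_ + _).
  by rewrite !scalerA mulrC.
by congr (_ *: (_ *: _)); apply: eq_bigr => i _; rewrite fconsS.
Qed.

(** Jensen's inequality introduces a ghost sample [g]; swapping coordinates of [f] and [g] according
    to [s] inserts the signs; subadditivity then separates [f] from [g]. An abstract sublinear [Psi]
    covers both a seminorm and a supremum over a function class. *)
Lemma symmetrization n (V : lmodType R) (Psi : V -> R) (e : T -> V) : (0 < n)%N ->
  (forall u w, Psi (u + w) <= Psi u + Psi w) ->
  (forall (a : R) u, 0 <= a -> Psi (a *: u) = a * Psi u) ->
  \sum_(f : {ffun 'I_n -> T}) pweight p f *
     Psi (n%:R^-1 *: (\sum_i e (f i)) - \sum_t p t *: e t) <=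
  2 * \sum_(f : {ffun 'I_n -> T}) pweight p f *
     ((2 ^+ n)%:R^-1 * \sum_(s : {ffun 'I_n -> bool})
        Psi (\sum_i (n%:R^-1 * rsign (s i)) *: e (f i))).
Proof.
move=> n0 PD PZ.
have nR : n%:R != 0 :> R by rewrite pnatr_eq0 -lt0n.
pose dif (f g : {ffun 'I_n -> T}) : V := \sum_i n%:R^-1 *: (e (f i) - e (g i)).
have ghost (f : {ffun 'I_n -> T}) : Psi (n%:R^-1 *: (\sum_i e (f i)) - \sum_t p t *: e t) <=
    \sum_(g : {ffun 'I_n -> T}) pweight p g * Psi (dif f g).
  apply: le_trans (sublinear_jensen (dif f) PD PZ (@pweight_ge0 n)).
  rewrite le_eqVlt; apply/orP; left; apply/eqP; congr Psi.
  rewrite (eq_bigr (fun g => pweight p g *: (n%:R^-1 *: (\sum_i e (f i))) -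
     n%:R^-1 *: (pweight p g *: (\sum_i e (g i))))).
    rewrite sumrB -scaler_suml pweight_sum1 scale1r -scaler_sumr expect_sum_coord.
    by rewrite scalerA mulVf// scale1r.
  move=> g _; rewrite /dif -scaler_sumr sumrB !scalerBr; congr (_ - _).
  by rewrite !scalerA mulrC.
(* Exchanging the sample and the ghost sample where [s] is [false] preserves the weights. *)
pose swp (s : {ffun 'I_n -> bool}) (f g : {ffun 'I_n -> T}) : {ffun 'I_n -> T} :=
  [ffun i => if s i then f i else g i].
pose DD s := \sum_f \sum_g pweight p f * pweight p g * Psi (dif (swp s f g) (swp s g f)).
pose D1 : R := \sum_(f : {ffun 'I_n -> T}) \sum_(g : {ffun 'I_n -> T})
  pweight p f * pweight p g * Psi (dif f g).
have DDE s : D1 = DD s.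
  rewrite /D1 /DD !pair_big /=.
  rewrite (reindex (fun fg => (swp s fg.1 fg.2, swp s fg.2 fg.1))) /=; last first.
    exists (fun fg => (swp s fg.1 fg.2, swp s fg.2 fg.1)) => -[f g] _ /=;
      by congr pair; apply/ffunP => i; rewrite !ffunE; case: (s i).
  apply: eq_bigr => -[f g] _ /=; congr (_ * _).
  rewrite /pweight -!big_split /=; apply: eq_bigr => i _.
  by rewrite !ffunE; case: (s i); rewrite // mulrC.
pose Rd (f : {ffun 'I_n -> T}) (s : {ffun 'I_n -> bool}) :=
  Psi (\sum_i (n%:R^-1 * rsign (s i)) *: e (f i)).
(* [Psi] may fail to be even, so the ghost half keeps the opposite signs [ng s]; averaging over all
   [s] makes the two halves equal, whence the factor 2. *)
pose ng (s : {ffun 'I_n -> bool}) : {ffun 'I_n -> bool} := [ffun i => ~~ s i].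
have bnd s : D1 <= \sum_f pweight p f * (Rd f s + Rd f (ng s)).
  have -> : \sum_f pweight p f * (Rd f s + Rd f (ng s)) =
      \sum_f \sum_g pweight p f * pweight p g * (Rd f s + Rd g (ng s)).
    under eq_bigr do rewrite mulrDr.
    rewrite big_split /=.
    under [RHS]eq_bigr do under eq_bigr do rewrite mulrDr.
    under [RHS]eq_bigr do rewrite big_split /=.
    rewrite big_split /=; congr (_ + _).
      apply: eq_bigr => f _.
      under eq_bigr do rewrite -mulrA mulrCA.
      by rewrite -mulr_suml pweight_sum1 mul1r.
    rewrite exchange_big /=; apply: eq_bigr => f _.
    under eq_bigr do rewrite -mulrA.
    by rewrite -mulr_suml pweight_sum1 mul1r.
  rewrite (DDE s); apply: ler_sum => f _; apply: ler_sum => g _.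
  rewrite ler_wpM2l ?mulr_ge0 ?pweight_ge0//.
  apply: le_trans (PD _ _); rewrite le_eqVlt; apply/orP; left; apply/eqP; congr Psi.
  rewrite -big_split /=; apply: eq_bigr => i _; rewrite !ffunE scalerBr /rsign.
  by case: (s i) => /=; rewrite mulr1 mulrN1 scaleNr// addrC.
have card2 : (2 ^+ n)%:R = \sum_(s : {ffun 'I_n -> bool}) 1 :> R.
  by rewrite sumr_const card_ffun card_bool card_ord.
have c2 : 0 < (2 ^+ n)%:R :> R by rewrite natrX exprn_gt0.
apply: (@le_trans _ _ D1).
  rewrite /D1; apply: ler_sum => f _.
  rewrite (eq_bigr (fun g => pweight p f * (pweight p g * Psi (dif f g)))).
    by rewrite -mulr_sumr ler_wpM2l ?pweight_ge0.
  by move=> g _; rewrite mulrA.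
have -> : \sum_f pweight p f * ((2 ^+ n)%:R^-1 * \sum_s Rd f s) =
   (2 ^+ n)%:R^-1 * \sum_s \sum_f pweight p f * Rd f s.
  rewrite [X in _ = _ * X]exchange_big mulr_sumr; apply: eq_bigr => f _.
  by rewrite -mulr_sumr; ring.
rewrite mulrCA -(ler_pM2l c2) mulVKf ?gt_eqF//.
rewrite {1}card2 mulr_suml.
apply: (@le_trans _ _ (\sum_(s : {ffun 'I_n -> bool}) \sum_f pweight p f * (Rd f s + Rd f (ng s)))).
  by apply: ler_sum => s _; rewrite mul1r.
under eq_bigr do under eq_bigr do rewrite mulrDr.
under eq_bigr do rewrite big_split /=.
rewrite big_split /= mulr_natl mulr2n lerD2l le_eqVlt; apply/orP; left; apply/eqP.
rewrite [RHS](reindex ng) //.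
by exists ng => s _; apply/ffunP => i; rewrite !ffunE negbK.
Qed.

End ProductWeights.

(** * Contraction and the deviation statistic *)

Section Suprema.
Context {R : realType} {I : Type} (A : set I).
Hypothesis A0 : A !=set0.

(** Certifies that [sup] is a genuine supremum and not its default value. The bound is two-sided so
    as to survive multiplication by constants of either sign. *)
Definition bounded_on (f : I -> R) := exists M, forall a, A a -> `|f a| <= M.

Lemma bounded_on_sup_ge (f : I -> R) a : bounded_on f -> A a -> f a <= sup (f @` A).
Proof.
move=> [M bf] Aa; apply: ub_le_sup; last by exists a.
by exists M => _ [b Ab <-]; rewrite (le_trans _ (bf _ Ab))// ler_norm.
Qed.

Lemma sup_image_le (f : I -> R) c : (forall a, A a -> f a <= c) -> sup (f @` A) <= c.
Proof.
case: A0 => a Aa fc; apply: ge_sup; first by exists (f a); exists a.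
by move=> _ [b Ab <-]; exact: fc.
Qed.

Lemma bounded_onD f g : bounded_on f -> bounded_on g -> bounded_on (fun a => f a + g a).
Proof.
move=> [M bf] [M' bg]; exists (M + M') => a Aa.
by rewrite (le_trans (ler_normD _ _))// lerD ?bf ?bg.
Qed.

Lemma bounded_onZ c f : bounded_on f -> bounded_on (fun a => c * f a).
Proof.
by move=> [M bf]; exists (`|c| * M) => a Aa; rewrite normrM ler_wpM2l ?bf.
Qed.

Lemma bounded_on_sum (J : finType) (f : J -> I -> R) :
  (forall j, bounded_on (f j)) -> bounded_on (fun a => \sum_j f j a).
Proof.
move=> bf; have /choice[M MP] := bf; exists (\sum_j M j) => a Aa.
by rewrite (le_trans (ler_norm_sum _ _ _))// ler_sum// => j _; exact: MP.
Qed.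

(** For [a] and [b] tested in the two left suprema, [g a - g b <= |f a - f b|]. Depending on the
    sign of [f a - f b], the pair is tested on the right in the order [(a, b)] or [(b, a)]. *)
Lemma contraction_pair (h f g : I -> R) : bounded_on h -> bounded_on f ->
  (forall a b, A a -> A b -> `|g a - g b| <= `|f a - f b|) ->
  sup ((fun a => h a + g a) @` A) + sup ((fun a => h a - g a) @` A) <=
  sup ((fun a => h a + f a) @` A) + sup ((fun a => h a - f a) @` A).
Proof.
move=> bh bf gf; set S := leRHS.
rewrite -lerBrDr; apply: sup_image_le => a Aa.
rewrite lerBrDr addrC -lerBrDr; apply: sup_image_le => b Ab.
rewrite lerBrDr.
have bD : bounded_on (fun a => h a + f a) by exact: bounded_onD.
have bB : bounded_on (fun a => h a - f a).
  apply: bounded_onD => //; have [M bM] := bf; exists M => c Ac.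
  by rewrite normrN bM.
have := bounded_on_sup_ge bD Aa; have := bounded_on_sup_ge bD Ab.
have := bounded_on_sup_ge bB Aa; have := bounded_on_sup_ge bB Ab.
rewrite /S; set s1 := sup _; set s2 := sup _ => h1 h2 h3 h4.
have := gf _ _ Aa Ab; have := ler_norm (g a - g b).
by case: (ler0P (f a - f b)); lra.
Qed.

(** The free term [h] carries the induction: it first absorbs the head while the tail changes from
    [g] to [f], then absorbs the tail while [contraction_pair] changes the head. *)
Lemma contraction n (h : I -> R) (f g : 'I_n -> I -> R) : bounded_on h ->
  (forall i, bounded_on (f i)) -> (forall i, bounded_on (g i)) ->
  (forall i a b, A a -> A b -> `|g i a - g i b| <= `|f i a - f i b|) ->
  \sum_(s : {ffun 'I_n -> bool}) sup ((fun a => h a + \sum_i rsign (s i) * g i a) @` A) <=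
  \sum_(s : {ffun 'I_n -> bool}) sup ((fun a => h a + \sum_i rsign (s i) * f i a) @` A).
Proof.
elim: n h f g => [|n IHn] h f g bh bf bg gf.
  apply: ler_sum => s _; rewrite le_eqVlt; apply/orP; left; apply/eqP.
  by congr (sup (_ @` _)); apply/funext => a; rewrite !big_ord0.
rewrite !sum_ffunS.
have step (k : 'I_n.+1 -> I -> R) x (s : {ffun 'I_n -> bool}) :
   (fun a => h a + \sum_i rsign (fcons x s i) * k i a) =
   (fun a => (h a + rsign x * k ord0 a) + \sum_i rsign (s i) * k (lift ord0 i) a).
  apply/funext => a; rewrite big_ord_recl fcons0 addrA; congr (_ + _).
  by apply: eq_bigr => i _; rewrite fconsS.
under eq_bigr do under eq_bigr do rewrite step.
under [leRHS]eq_bigr do under eq_bigr do rewrite step.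
apply: (@le_trans _ _ (\sum_x \sum_(s : {ffun 'I_n -> bool})
  sup ((fun a => (h a + rsign x * g ord0 a) + \sum_i rsign (s i) * f (lift ord0 i) a) @` A))).
  apply: ler_sum => x _; apply: IHn => // [|i a b]; last exact: gf.
  by apply: bounded_onD => //; exact: bounded_onZ.
rewrite !big_bool /= -!big_split /=; apply: ler_sum => s _.
have E (k : I -> R) x : (fun a => (h a + rsign x * k a) + \sum_i rsign (s i) * f (lift ord0 i) a) =
    (fun a => (h a + \sum_i rsign (s i) * f (lift ord0 i) a) + rsign x * k a).
  by apply/funext => a; rewrite addrAC.
have Et (k : I -> R) : (fun a => (h a + rsign true * k a) + \sum_i rsign (s i) * f (lift ord0 i) a) =
    (fun a => (h a + \sum_i rsign (s i) * f (lift ord0 i) a) + k a).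
  by rewrite E; apply/funext => a; rewrite /rsign mul1r.
have Ef (k : I -> R) : (fun a => (h a + rsign false * k a) + \sum_i rsign (s i) * f (lift ord0 i) a) =
    (fun a => (h a + \sum_i rsign (s i) * f (lift ord0 i) a) - k a).
  by rewrite E; apply/funext => a; rewrite /rsign mulN1r.
rewrite !Et !Ef; apply: contraction_pair => [||a b Aa Ab] //; last exact: gf.
apply: bounded_onD => //; apply: bounded_on_sum => i; exact: bounded_onZ.
Qed.

End Suprema.

Lemma pos_part_lip (R : realType) (u v : R) :
  `|pos_part u - pos_part v| <= `|u - v|.
Proof.
rewrite /pos_part !maxEle.
by case: (leP u 0) => hu; case: (leP v 0) => hv; rewrite ?subrr ?normr0//;
  case: (ler0P (u - v)) => h1; rewrite ler_norml; apply/andP; split; lra.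
Qed.

(** * Seminorms and the scalar product *)

Definition seminorm {R : realType} {V : lmodType R} (H : V -> R) :=
  (forall u v, H (u + v) <= H u + H v) /\ (forall (a : R) u, H (a *: u) = `|a| * H u).

Section Seminorm.
Context {R : realType} {V : lmodType R} {H : V -> R}.
Hypothesis semiH : seminorm H.

Lemma seminorm0 : H 0 = 0.
Proof. by rewrite -[X in H X](scale0r 0) semiH.2 normr0 mul0r. Qed.

Lemma seminormN u : H (- u) = H u.
Proof. by rewrite -scaleN1r semiH.2 normrN1 mul1r. Qed.

Lemma seminorm_ge0 u : 0 <= H u.
Proof. by have := semiH.1 u (- u); rewrite subrr seminorm0 seminormN; lra. Qed.

Lemma seminorm_sum (I : finType) (v : I -> V) : H (\sum_i v i) <= \sum_i H (v i).
Proof.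
elim/big_rec2 : _ => [|i y x _ h]; first by rewrite seminorm0.
by rewrite (le_trans (semiH.1 _ _))// lerD2l.
Qed.

Lemma seminormB u v : H (u - v) <= H u + H v.
Proof. by rewrite -[H v]seminormN semiH.1. Qed.

Lemma seminorm_dist u v : `|H u - H v| <= H (u - v).
Proof.
rewrite ler_norml; apply/andP; split.
  have := semiH.1 (v - u) u; rewrite subrK -[H (v - u)]seminormN opprB; lra.
have := semiH.1 (u - v) v; rewrite subrK; lra.
Qed.

End Seminorm.

Definition dotv {R : realType} {d} (u v : 'cV[R]_d) : R := (u^T *m v) ord0 ord0.

Section Dotv.
Context {R : realType} {d : nat}.
Implicit Types u v w : 'cV[R]_d.

Lemma dotvDl u v w : dotv (u + v) w = dotv u w + dotv v w.
Proof. by rewrite /dotv linearD mulmxDl mxE. Qed.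

Lemma dotvZl (c : R) u w : dotv (c *: u) w = c * dotv u w.
Proof. by rewrite /dotv linearZ -scalemxAl mxE. Qed.

Lemma dotvBl u v w : dotv (u - v) w = dotv u w - dotv v w.
Proof. by rewrite -scaleN1r dotvDl dotvZl mulN1r. Qed.

Lemma dotv_suml (I : finType) (u : I -> 'cV[R]_d) w :
  dotv (\sum_i u i) w = \sum_i dotv (u i) w.
Proof. by rewrite /dotv raddf_sum mulmx_suml summxE. Qed.

Lemma dotvC u v : dotv u v = dotv v u.
Proof.
have : (u^T *m v)^T = v^T *m u by rewrite trmx_mul trmxK.
by rewrite /dotv => <-; rewrite [RHS]mxE.
Qed.

End Dotv.

(** * The deviation statistic over a finite alphabet *)

Section FiniteSample.
Context {R : realType} {T : finType} (p : T -> R).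
Hypothesis p_ge0 : forall t, 0 <= p t.
Hypothesis p_sum1 : \sum_t p t = 1.
Context {d : nat} (H : 'cV[R]_d -> R) (x : T -> 'cV[R]_d) (r L Xs : R).
Hypothesis semiH : seminorm H.
Hypothesis r0 : 0 < r.
Hypothesis L0 : 0 <= L.
Hypothesis Hx : forall t, H (x t) <= Xs.

(** The ball of radius [L] for the dual of [H]. It is independent of the sample and of the
    discretization, and it stands in for the ball of matrices. *)
Definition polar : set 'cV[R]_d := [set a | forall v, `|dotv v a| <= L * H v].

Definition hinge (a : 'cV[R]_d) (u : 'cV[R]_d) : R := pos_part (1 - r^-1 * dotv u a).

(* Extends the supremum to signed weights [q], on which it is sublinear, so that
   [symmetrization] applies with Dirac masses as vectors. *)
Definition hinge_dev (q : {ffun T -> R^o}) : R :=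
  sup ((fun a => \sum_t q t * hinge a (x t)) @` polar).

Local Notation kap := (L / r).

Definition sample_dev m (f : {ffun 'I_m -> T}) : R :=
  kap * H (m%:R^-1 *: \sum_i x (f i) - \sum_t p t *: x t) +
  sup ((fun a => m%:R^-1 * \sum_i hinge a (x (f i)) - \sum_t p t * hinge a (x t)) @` polar).

Definition finite_rademacher m : R :=
  \sum_(f : {ffun 'I_m -> T}) pweight p f * ((2 ^+ m)%:R^-1 *
    \sum_(s : {ffun 'I_m -> bool}) H (\sum_i (m%:R^-1 * rsign (s i)) *: x (f i))).

Let kapE h : kap * h = r^-1 * (L * h).
Proof. by ring. Qed.

Lemma polar0 : polar !=set0.
Proof.
by exists 0 => v; rewrite /dotv mulmx0 mxE normr0 mulr_ge0// seminorm_ge0.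
Qed.

Lemma hinge_lip a u v : polar a -> `|hinge a u - hinge a v| <= kap * H (u - v).
Proof.
move=> Aa; rewrite /hinge (le_trans (pos_part_lip _ _))//.
have -> : 1 - r^-1 * dotv u a - (1 - r^-1 * dotv v a) = - (r^-1 * dotv (u - v) a).
  by rewrite dotvBl; ring.
rewrite normrN normrM gtr0_norm ?invr_gt0// kapE ler_wpM2l ?invr_ge0 ?(ltW r0)//.
Qed.

Lemma hinge_bounded u : bounded_on polar (hinge^~ u).
Proof.
exists (1 + kap * H u) => a Aa.
(* Comparison with the point 0, where every hinge equals 1. *)
have /hinge_lip : polar a by []. move=> /(_ u 0); rewrite subr0.
have -> : hinge a 0 = 1.
  by rewrite /hinge /dotv trmx0 mul0mx mxE mulr0 subr0 /pos_part maxEle leNgt ltr01.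
have := ler_normD (hinge a u - 1) 1; rewrite subrK normr1; lra.
Qed.

Lemma hinge_comb_bounded (q : T -> R) : bounded_on polar (fun a => \sum_t q t * hinge a (x t)).
Proof. by apply: bounded_on_sum => t; apply: bounded_onZ; exact: hinge_bounded. Qed.

Lemma hinge_devD q q' : hinge_dev (q + q') <= hinge_dev q + hinge_dev q'.
Proof.
apply: sup_image_le => [|a Aa]; first exact: polar0.
have := bounded_on_sup_ge (hinge_comb_bounded q) Aa.
have := bounded_on_sup_ge (hinge_comb_bounded q') Aa.
have E t : (q + q') t * hinge a (x t) = q t * hinge a (x t) + q' t * hinge a (x t).
  by rewrite ffunE mulrDl.
rewrite (eq_bigr _ (fun t _ => E t)).
rewrite big_split /= -/(hinge_dev q) -/(hinge_dev q'); lra.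
Qed.

(** One inequality holds for every nonnegative factor; for [c > 0] the other is the same inequality
    at [c^-1]. *)
Lemma hinge_devZ (c : R) q : 0 <= c -> hinge_dev (c *: q) = c * hinge_dev q.
Proof.
have E (b : R) (q' : {ffun T -> R^o}) a : \sum_t (b *: q') t * hinge a (x t) = b * \sum_t q' t * hinge a (x t).
  by rewrite mulr_sumr; apply: eq_bigr => t _; rewrite ffunE mulrA.
have le (b : R) q' : 0 <= b -> hinge_dev (b *: q') <= b * hinge_dev q'.
  move=> b0; apply: sup_image_le => [|a Aa]; first exact: polar0.
  by rewrite E ler_wpM2l//; exact: (bounded_on_sup_ge (hinge_comb_bounded q') Aa).
rewrite le_eqVlt => /predU1P[<-|c0].
  rewrite mul0r scale0r /hinge_dev (_ : _ @` _ = [set 0]) ?sup1//.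
  apply/seteqP; split => [_ [a Aa <-]|_ ->] /=.
    by rewrite big1// => t _; rewrite ffunE mul0r.
  by have [a Aa] := polar0; exists a => //; rewrite big1// => t _; rewrite ffunE mul0r.
apply/eqP; rewrite eq_le le ?(ltW c0)//=.
rewrite -ler_pdivlMl//; apply: le_trans (le _ _ _); last by rewrite invr_ge0 ltW.
by rewrite scalerA mulVf ?gt_eqF// scale1r.
Qed.

Definition dirac_ffun (t : T) : {ffun T -> R^o} := [ffun t' => (t' == t)%:R].

Lemma comb_dirac (F : T -> R) (J : finType) (c : J -> R) (t : J -> T) :
  \sum_u (\sum_j c j *: dirac_ffun (t j)) u * F u = \sum_j c j * F (t j).
Proof.
under eq_bigr do rewrite sum_ffunE mulr_suml.
rewrite exchange_big /=; apply: eq_bigr => j _.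
rewrite (bigD1 (t j)) //= big1 => [|u ut]; rewrite !ffunE ?eqxx.
  by rewrite addr0 /GRing.scale /= mulr1.
by rewrite (negbTE ut) scaler0 mul0r.
Qed.

Lemma sample_devE m (f : {ffun 'I_m -> T}) :
  sample_dev f = kap * H (m%:R^-1 *: \sum_i x (f i) - \sum_t p t *: x t) +
    hinge_dev (m%:R^-1 *: \sum_i dirac_ffun (f i) - \sum_t p t *: dirac_ffun t).
Proof.
rewrite /sample_dev /hinge_dev; congr (_ + sup (_ @` _)); apply/funext => a.
rewrite scaler_sumr.
under [RHS]eq_bigr do rewrite !ffunE mulrBl.
by rewrite sumrB !comb_dirac mulr_sumr.
Qed.

(** The factor 4 is 2 + 2: each term of [sample_dev] is symmetrized at the cost of a factor 2, and
    each is then controlled by [kap] times the Rademacher average. *)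
Lemma expect_sample_dev m : (0 < m)%N ->
  \sum_(f : {ffun 'I_m -> T}) pweight p f * sample_dev f <= 4 * kap * finite_rademacher m.
Proof.
move=> m0.
have kap0 : 0 <= kap by rewrite divr_ge0// ltW.
under eq_bigr do rewrite sample_devE mulrDr.
rewrite big_split /=.
have -> : 4 * kap * finite_rademacher m =
  kap * (2 * finite_rademacher m) + 2 * (kap * finite_rademacher m) by ring.
apply: lerD.
  under eq_bigr do rewrite mulrCA.
  rewrite -mulr_sumr ler_wpM2l//; apply: symmetrization => // [|c u c0].
    exact: semiH.1.
  by rewrite semiH.2 ger0_norm.
apply: le_trans (symmetrization p_ge0 p_sum1 dirac_ffun m0 hinge_devD hinge_devZ) _.
rewrite ler_pM2l// mulr_sumr; apply: ler_sum => f _.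
rewrite [leRHS]mulrCA ler_wpM2l ?pweight_ge0// [leRHS]mulrCA ler_wpM2l ?invr_ge0//.
rewrite /hinge_dev.
pose g (i : 'I_m) a := m%:R^-1 * hinge a (x (f i)).
(* [k] is the argument of the positive part in [g] without its constant 1, which cancels in the
   increments compared by contraction. *)
pose k (i : 'I_m) a := - (m%:R^-1 * (r^-1 * dotv (x (f i)) a)).
have mi0 : 0 <= m%:R^-1 :> R by rewrite invr_ge0.
rewrite (eq_bigr (fun s : {ffun 'I_m -> bool} =>
   sup ((fun a => 0 + \sum_i rsign (s i) * g i a) @` polar))); last first.
  move=> s _; congr (sup (_ @` _)); apply/funext => a; rewrite comb_dirac add0r.
  by apply: eq_bigr => i _; rewrite /g; ring.
apply: (@le_trans _ _ (\sum_(s : {ffun 'I_m -> bool})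
   sup ((fun a => 0 + \sum_i rsign (s i) * k i a) @` polar))).
  apply: (contraction polar0) => [|i|i|i a b Aa Ab].
  - by exists 0 => a _; rewrite normr0.
  - exists (m%:R^-1 * (r^-1 * (L * H (x (f i))))) => a Aa.
    rewrite /k normrN !normrM ger0_norm// gtr0_norm ?invr_gt0//.
    by rewrite !ler_wpM2l ?invr_ge0 ?(ltW r0)//.
  - by apply: bounded_onZ; exact: hinge_bounded.
  - rewrite /g /k -mulrBr -opprD normrN -mulrBr !normrM ler_wpM2l//.
    rewrite /hinge (le_trans (pos_part_lip _ _))//.
    rewrite le_eqVlt; apply/orP; left; apply/eqP.
    rewrite -normrN; congr (`|_|); ring.
rewrite mulr_sumr; apply: ler_sum => s _.
apply: sup_image_le => [|a Aa]; first exact: polar0.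
rewrite add0r.
have -> : \sum_i rsign (s i) * k i a =
    - (r^-1 * dotv (\sum_i (m%:R^-1 * rsign (s i)) *: x (f i)) a).
  rewrite dotv_suml mulr_sumr -sumrN; apply: eq_bigr => i _.
  by rewrite dotvZl /k; ring.
(* After contraction the class is linear in [a], so membership in [polar] bounds it by [L H] of the
   signed mean. *)
rewrite (le_trans (ler_norm _))// normrN normrM gtr0_norm ?invr_gt0//.
by rewrite kapE ler_wpM2l ?invr_ge0 ?(ltW r0)//; exact: Aa.
Qed.

(** Replacing one point moves the empirical mean by at most [2 Xs / m] in [H], hence each of the two
    terms by at most [2 kap Xs / m]. *)
Lemma sample_dev_bounded_diff m : bounded_diff (4 * kap * Xs / m%:R) (@sample_dev m).
Proof.
move=> f g k fg.
have kap0 : 0 <= kap by rewrite divr_ge0// ltW.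
have mi0 : 0 <= m%:R^-1 :> R by rewrite invr_ge0.
have sumE (V : zmodType) (F : T -> V) :
    \sum_i F (f i) - \sum_i F (g i) = F (f k) - F (g k).
  rewrite -sumrB (bigD1 k)//= big1 ?addr0// => i ik.
  by rewrite fg// subrr.
have Hd : H (x (f k) - x (g k)) <= 2 * Xs.
  rewrite (le_trans (seminormB semiH _ _))//.
  by have := Hx (f k); have := Hx (g k); lra.
have -> : 4 * kap * Xs / m%:R = kap * (m%:R^-1 * (2 * Xs)) + m%:R^-1 * (kap * (2 * Xs)).
  by ring.
have e1 : H (m%:R^-1 *: \sum_i x (f i) - \sum_t p t *: x t) -
   H (m%:R^-1 *: \sum_i x (g i) - \sum_t p t *: x t) <= m%:R^-1 * (2 * Xs).
  apply: le_trans (ler_norm _) _; apply: le_trans (seminorm_dist semiH _ _) _.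
  rewrite opprB addrA subrK -scalerBr sumE semiH.2 ger0_norm//.
  by rewrite ler_wpM2l.
rewrite /sample_dev opprD addrACA -mulrBr; apply: lerD; first by rewrite ler_wpM2l.
set G := fun h : {ffun 'I_m -> T} => fun a =>
  m%:R^-1 * \sum_i hinge a (x (h i)) - \sum_t p t * hinge a (x t).
rewrite lerBlDr; apply: sup_image_le => [|a Aa]; first exact: polar0.
have bG : bounded_on polar (G g).
  apply: bounded_onD.
    by apply: bounded_onZ; apply: bounded_on_sum => i; exact: hinge_bounded.
  have [M bM] := hinge_comb_bounded p.
  by exists M => b Ab; rewrite normrN bM.
have := bounded_on_sup_ge bG Aa.
suff : G f a - G g a <= m%:R^-1 * (kap * (2 * Xs)) by rewrite /G; lra.
rewrite /G opprB addrA subrK -mulrBr (sumE R (fun t => hinge a (x t))).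
rewrite ler_wpM2l// (le_trans (ler_norm _))// (le_trans (hinge_lip _ _ Aa))//.
by rewrite ler_wpM2l.
Qed.

(** McDiarmid's inequality with [c = 4 kap Xs / m]. Raising the mean to its upper bound only shrinks
    the event. *)
Lemma finite_tail m (e : R) : (0 < m)%N -> 0 < kap -> 0 < Xs -> 0 <= e ->
  \sum_(f : {ffun 'I_m -> T} | 4 * kap * finite_rademacher m + e <= sample_dev f) pweight p f <=
  expR (- (m%:R * e ^+ 2 / (8 * (kap * Xs) ^+ 2))).
Proof.
move=> m0 kap0 Xs0 e0.
have mR : 0 < m%:R :> R by rewrite ltr0n.
have L1 : 0 < L by move: kap0; rewrite pmulr_lgt0 ?invr_gt0.
have c0 : 0 < 4 * kap * Xs / m%:R by rewrite divr_gt0// (mulr_gt0 (mulr_gt0 _ kap0) Xs0).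
have := mcdiarmid p_ge0 p_sum1 m0 c0 e0 (@sample_dev_bounded_diff m).
rewrite (_ : 2 * e ^+ 2 / _ = m%:R * e ^+ 2 / (8 * (kap * Xs) ^+ 2)); last first.
  by field; rewrite !(gt_eqF L1, gt_eqF r0, gt_eqF Xs0, gt_eqF mR).
apply: le_trans; rewrite [leRHS](bigID (fun f => 4 * kap * finite_rademacher m + e <= sample_dev f)) /=.
have nn := pweight_ge0 p_ge0.
rewrite -[leLHS]addr0 lerD ?sumr_ge0//.
rewrite le_eqVlt; apply/orP; left; apply/eqP; apply: eq_bigl => f.
apply/idP/andP => [h|[]//]; split => //.
by rewrite (le_trans _ h)// lerD2r expect_sample_dev.
Qed.

End FiniteSample.

(** * Approximation by finitely many cells *)

Section BoundedIntegral.
Context {dO : measure_display} {Om : measurableType dO} {R : realType}.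
Variable P : probability Om R.

Lemma ae_bounded_integral (f : Om -> R) (M : R) : measurable_fun setT f ->
  0 <= M -> {ae P, forall w, `|f w| <= M} ->
  (\int[P]_w `|(f w)%:E| <= M%:E)%E.
Proof.
move=> mf M0 fM; rewrite -[leRHS]mule1 -(@probability_setT _ _ _ P).
apply: integral_le_bound => //; first exact/measurable_EFinP.
by apply: filterS fM => w fw _; rewrite lee_fin.
Qed.

Lemma ae_bounded_integrable (f : Om -> R) (M : R) : measurable_fun setT f ->
  0 <= M -> {ae P, forall w, `|f w| <= M} -> P.-integrable setT (EFin \o f).
Proof.
move=> mf M0 fM; apply/integrableP; split; first exact/measurable_EFinP.
exact: le_lt_trans (ae_bounded_integral mf M0 fM) (ltry _).
Qed.

Lemma ae_bounded_Rintegral (f : Om -> R) (M : R) : measurable_fun setT f ->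
  0 <= M -> {ae P, forall w, `|f w| <= M} -> `|Rintegral P setT f| <= M.
Proof.
move=> mf M0 fM; have fi := ae_bounded_integrable mf M0 fM.
rewrite -lee_fin EFin_normr_Rintegral//.
apply: le_trans (ae_bounded_integral mf M0 fM); apply: le_abse_integral => //.
exact/measurable_EFinP.
Qed.

Context {K : finType} (cell : Om -> K).
Hypothesis mcell : forall k, measurable (cell @^-1` [set k]).

Definition cell_mass (k : K) : R := fine (P (cell @^-1` [set k])).

Lemma cell_mass_ge0 k : 0 <= cell_mass k.
Proof. exact: fine_ge0. Qed.

Lemma EFin_cell_mass k : (cell_mass k)%:E = P (cell @^-1` [set k]).
Proof. by rewrite fineK// fin_num_measure. Qed.

Lemma cell_comp_indic (g : K -> R) w :
  g (cell w) = \sum_k g k * \1_(cell @^-1` [set k]) w.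
Proof.
rewrite (bigD1 (cell w))//= big1 => [|k kw].
  by rewrite indicE mem_set// mulr1 addr0.
by rewrite indicE memNset ?mulr0// => /= wk; move: kw; rewrite wk eqxx.
Qed.

Lemma measurable_cell_comp (g : K -> R) : measurable_fun setT (g \o cell).
Proof.
rewrite (_ : _ \o _ = fun w => \sum_k g k * \1_(cell @^-1` [set k]) w); last first.
  by apply/funext => w; exact: cell_comp_indic.
by apply: measurable_sum => k; apply: measurable_funM.
Qed.

Lemma Rintegral_cell_comp (g : K -> R) :
  Rintegral P setT (g \o cell) = \sum_k cell_mass k * g k.
Proof.
rewrite /Rintegral.
under eq_integral do rewrite /= cell_comp_indic -sumEFin.
rewrite integral_sum//=; last first.
  move=> k; apply: (@ae_bounded_integrable _ `|g k|) => //.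
    exact: measurable_funM.
  apply: aeW => w; rewrite normrM ler_piMr// indicE.
  by case: (_ \in _); rewrite ?normr1 ?normr0.
rewrite (eq_bigr (fun k => (cell_mass k * g k)%:E)) ?sumEFin// => k _.
under eq_integral do rewrite EFinM.
rewrite integralZl//; last exact: integrable_indic.
by rewrite integral_indic// setIT EFinM EFin_cell_mass muleC.
Qed.

Lemma cell_mass_sum1 : \sum_k cell_mass k = 1.
Proof.
rewrite (eq_bigr (fun k => cell_mass k * 1)); last by move=> k _; rewrite mulr1.
rewrite -(Rintegral_cell_comp (fun=> 1)).
apply: etrans (Rintegral_cst P measurableT 1) _.
by rewrite mul1r; exact: (congr1 fine (@probability_setT _ _ _ P)).
Qed.

Lemma probability_cell (Q : pred K) :
  P [set w | Q (cell w)] = (\sum_(k | Q k) cell_mass k)%:E.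
Proof.
pose g k : R := (Q k)%:R.
have gE w : (g (cell w))%:E = (\1_[set w | Q (cell w)] w)%:E.
  by rewrite /g indicE /=; congr (nat_of_bool _)%:R%:E; apply/idP/idP; rewrite inE.
have mQ : measurable [set w | Q (cell w)].
  rewrite (_ : mkset _ = (g \o cell) @^-1` [set 1]).
    by rewrite -[X in measurable X]setTI; exact: measurable_cell_comp.
  apply/seteqP; split => w /=; rewrite /g; first by move=> ->.
  by case: (Q _) => // /eqP; rewrite eq_sym oner_eq0.
have := Rintegral_cell_comp g.
rewrite /Rintegral; under eq_integral do rewrite /= gE.
rewrite integral_indic// setIT => E.
rewrite -[LHS]fineK ?fin_num_measure// E; congr EFin.
rewrite [RHS]big_mkcond /=; apply: eq_bigr => k _; rewrite /g.
by case: (Q k); rewrite ?mulr1 ?mulr0.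
Qed.

(** Integrability of [f] comes from writing it as an almost surely bounded difference plus a
    function with finitely many values. *)
Lemma Rintegral_cell_approx (f : Om -> R) (g : K -> R) (e : R) :
  measurable_fun setT f -> 0 <= e -> {ae P, forall w, `|f w - g (cell w)| <= e} ->
  `|Rintegral P setT f - \sum_k cell_mass k * g k| <= e.
Proof.
move=> mf e0 fg; rewrite -Rintegral_cell_comp.
have mg := measurable_cell_comp g.
have gi : P.-integrable setT (EFin \o (g \o cell)).
  apply: (@ae_bounded_integrable _ (\sum_k `|g k|)) => //.
    exact: sumr_ge0.
  by apply: aeW => w /=; rewrite (bigD1 (cell w))//= lerDl sumr_ge0.
have mfg : measurable_fun setT (fun w => f w - (g \o cell) w).
  exact: measurable_funB.
have fgi := ae_bounded_integrable mfg e0 fg.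
have fi : P.-integrable setT (EFin \o f).
  rewrite (_ : EFin \o f = (EFin \o (fun w => f w - (g \o cell) w)) \+ (EFin \o (g \o cell))).
    exact: integrableD.
  by apply/funext => w /=; rewrite -EFinD subrK.
by rewrite -RintegralB//; exact: ae_bounded_Rintegral.
Qed.

End BoundedIntegral.

(** * Measurability of seminorms and discretization of bounded vectors *)

Section SeminormCoord.
Context {R : realType} {d : nat} {H : 'cV[R]_d -> R}.
Hypothesis semiH : seminorm H.

Lemma seminorm_coord_le (u : 'cV[R]_d) : H u <= \sum_j `|u j ord0| * H (delta_mx j ord0).
Proof.
rewrite {1}(matrix_sum_delta u).
rewrite (eq_bigr (fun i => u i ord0 *: delta_mx i ord0)); last first.
  by move=> i _; rewrite big_ord1.
rewrite (le_trans (seminorm_sum semiH _))//; apply: ler_sum => j _.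
by rewrite semiH.2.
Qed.

Lemma seminorm_coord_bound (u : 'cV[R]_d) e : (forall j, `|u j ord0| <= e) ->
  H u <= e * \sum_j H (delta_mx j ord0).
Proof.
move=> ue; rewrite (le_trans (seminorm_coord_le u))// mulr_sumr.
by apply: ler_sum => j _; rewrite ler_wpM2r ?seminorm_ge0.
Qed.

(* [H u] is the infimum over rational [q] of [H q] plus a weighted l1 distance from [u] to [q]. *)
Lemma measurable_seminorm {dO : measure_display} {Om : measurableType dO}
    (v : Om -> 'cV[R]_d) : (forall j, measurable_fun setT (fun w => v w j ord0)) ->
  measurable_fun setT (H \o v).
Proof.
move=> mv.
(* Enumeration of the rational vectors; integers that code no vector yield 0. *)
pose q (n : nat) : 'cV[R]_d :=
  if unpickle n is Some f then \col_j ratr ((f : {ffun 'I_d -> rat}) j) else 0.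
pose term n w := H (q n) + \sum_j `|v w j ord0 - q n j ord0| * H (delta_mx j ord0).
have mterm n : measurable_fun setT (term n).
  apply: measurable_funD => //; apply: measurable_sum => j.
  apply: measurable_funM => //; apply: measurableT_comp => //.
  exact: measurable_funB.
have Hterm n w : H (v w) <= term n w.
  have := seminorm_coord_le (v w - q n).
  rewrite (eq_bigr (fun j => `|v w j ord0 - q n j ord0| * H (delta_mx j ord0))).
    have := semiH.1 (v w - q n) (q n); rewrite subrK /term; lra.
  by move=> j _; rewrite !mxE.
have approx w e : 0 < e -> exists n, term n w <= H (v w) + e.
  move=> e0; pose C := \sum_j H (delta_mx j ord0).
  have C0 : 0 <= C by apply: sumr_ge0 => j _; exact: seminorm_ge0.
  (* Chosen so that [2 dl C <= e]; the added 1 covers [C = 0]. *)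
  pose dl := e / (2 * (C + 1)).
  have dl0 : 0 < dl by rewrite divr_gt0// mulr_gt0// ltr_wpDl.
  have /choice[f fP] j : exists r : rat, `|v w j ord0 - ratr r| <= dl.
    have : v w j ord0 - dl < v w j ord0 + dl by lra.
    move=> /rat_in_itvoo[r]; rewrite in_itv /= => /andP[h1 h2].
    by exists r; rewrite ler_norml; apply/andP; split; lra.
  exists (pickle (finfun f)).
  have qE j : q (pickle (finfun f)) j ord0 = ratr (f j).
    by rewrite /q pickleK mxE ffunE.
  rewrite /term; set n := pickle _.
  have S1 : \sum_j `|v w j ord0 - q n j ord0| * H (delta_mx j ord0) <= dl * C.
    rewrite mulr_sumr; apply: ler_sum => j _.
    by rewrite ler_wpM2r ?seminorm_ge0// qE.
  have S2 : H (q n - v w) <= dl * C.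
    apply: seminorm_coord_bound => j; rewrite !mxE qE distrC; exact: fP.
  have S3 := semiH.1 (q n - v w) (v w); rewrite subrK in S3.
  have : dl * C + dl * C <= e.
    rewrite -mulr2n -mulr_natl /dl -mulrA mulrCA mulrA.
    rewrite [X in X <= _](_ : _ = e * (C / (C + 1))); last first.
      by field; lra.
    by rewrite ler_piMr ?(ltW e0)// ler_pdivrMr; lra.
  lra.
rewrite (_ : H \o v = fun w => infs (term ^~ w) 0%N).
  apply: measurable_fun_infs => // w _; exists (H (v w)) => _ [n _ <-].
  exact: Hterm.
apply/funext => w /=; rewrite /infs.
have lb : lbound [set term k w | k in [set k | (0 <= k)%N]] (H (v w)).
  by move=> _ [n _ <-].
apply/eqP; rewrite eq_le; apply/andP; split.
  by apply: lb_le_inf => //; exists (term 0%N w); exists 0%N.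
apply/ler_addgt0Pr => e e0; have [n tn] := approx w e e0.
by apply: le_trans tn; apply: ge_inf; [exists (H (v w))|exists n].
Qed.

End SeminormCoord.

(** A cell is given by the answers to finitely many comparisons of coordinates with thresholds
    spaced by [e] from [-B] upwards. Each cell is thus a finite intersection of measurable sets. *)
Lemma finite_discretization (R : realType) (d : nat) {dO : measure_display}
    (Om : measurableType dO) (u : Om -> 'cV[R]_d) (S : set 'cV[R]_d) (B e : R) :
  (forall j, measurable_fun setT (fun w => u w j ord0)) ->
  S !=set0 -> (forall v, S v -> forall j, `|v j ord0| <= B) -> 0 < e ->
  exists (K : finType) (cell : Om -> K) (x : K -> 'cV[R]_d),
    [/\ forall k, measurable (cell @^-1` [set k]),
        forall k, S (x k) &
        forall w, S (u w) -> forall j, `|(u w - x (cell w)) j ord0| <= e].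
Proof.
move=> mu [v0 Sv0] SB e0.
pose n := (Num.truncn (2 * B / e)).+1.
pose thr (l : 'I_n) : R := l%:R * e - B.
pose code (v : 'cV[R]_d) : {ffun 'I_d * 'I_n -> bool} :=
  [ffun jl => thr jl.2 <= v jl.1 ord0].
(* If the gap exceeded [e], the last threshold below [v j] would lie above [v' j]. Its index is at
   most the truncation of [2 B / e], so the successor in [n] includes it. *)
have near v v' : S v -> S v' -> code v = code v' -> forall j, v j ord0 - v' j ord0 <= e.
  move=> Sv Sv' cvv' j; rewrite leNgt; apply/negP => lt.
  have := SB _ Sv j; have := SB _ Sv' j; rewrite !ler_norml => /andP[a1 a2] /andP[b1 b2].
  pose y := (v j ord0 + B) / e.
  have y0 : 0 <= y by rewrite divr_ge0 ?(ltW e0)//; lra.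
  have ly := truncn_itv y0.
  have ltn : (Num.truncn y < n)%N.
    rewrite ltnS; apply: le_truncn; rewrite ler_pM2r ?invr_gt0//; lra.
  have /andP[l1 l2] := ly.
  have /ffunP/(_ (j, Ordinal ltn)) := cvv'; rewrite !ffunE /= /thr /=.
  rewrite ler_pdivlMr// in l1; rewrite ltr_pdivrMr// -natr1 mulrDl mul1r in l2.
  have -> : (Num.truncn y)%:R * e - B <= v j ord0 by lra.
  by move/esym => h; lra.
(* Cells that miss [S] receive the default [v0], so that every representative lies in [S]. *)
pose x k := if pselect (exists v, S v /\ code v = k) is left h then projT1 (cid h) else v0.
exists {ffun 'I_d * 'I_n -> bool}, (fun w => code (u w)), x; split.
- move=> k.
  rewrite (_ : _ @^-1` _ = \bigcap_(jl in [set: 'I_d * 'I_n])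
    [set w | (thr jl.2 <= u w jl.1 ord0) = k jl]); last first.
    apply/seteqP; split => w /=.
      by move=> <- jl _ /=; rewrite ffunE.
    by move=> h; apply/ffunP => jl; rewrite ffunE; exact: (h jl I).
  apply: fin_bigcap_measurable => [|jl _]; first exact: finite_finset.
  have := mu jl.1 measurableT `[thr jl.2, +oo[%classic (measurable_itv _).
  rewrite setTI; case: (k jl).
    congr measurable; apply/seteqP; split => w /=; rewrite in_itv/= andbT//.
  move/measurableC; congr measurable; apply/seteqP; split => w /=; rewrite in_itv/= andbT.
    by move/negP/negbTE.
  by move=> ->.
- by move=> k; rewrite /x; case: pselect => // h; case: (projT2 (cid h)).
- move=> w Sw j; rewrite /x; case: pselect => [h|[]]; last by exists (u w).
  have [Sx cx] := projT2 (cid h); rewrite !mxE ler_norml; apply/andP; split.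
    have := near _ _ Sx Sw cx j; lra.
  exact: near _ _ Sw Sx (esym cx) j.
Qed.

(** * Dual norms *)

Lemma mx_coord_le_norm (R : realType) m n (A : 'M[R]_(m, n)) i j : `|A i j| <= `|A|.
Proof.
by rewrite [leRHS]/Num.norm /= mx_normrE; apply: (le_bigmax _ _ (i, j)).
Qed.

(** Suited to functionals defined by suprema, for which upper bounds are direct; the reverse
    inequality is the given one at [a^-1]. *)
Lemma seminormI (R : realType) (V : lmodType R) (f : V -> R) :
  (forall u v, f (u + v) <= f u + f v) ->
  (forall (a : R) u, f (a *: u) <= `|a| * f u) -> seminorm f.
Proof.
move=> fD fZ; split => // a u; apply/eqP; rewrite eq_le fZ/=.
have [->|a0] := eqVneq a 0.
  by rewrite normr0 mul0r scale0r; have := fD 0 0; rewrite addr0; lra.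
have := fZ a^-1 (a *: u); rewrite scalerA mulVf// scale1r normfV.
by rewrite ler_pdivlMl ?normr_gt0.
Qed.

Section RowNorm.
Context {R : realType} {n : nat} (f : 'rV[R]_n -> R).
Hypothesis semif : seminorm f.

Lemma seminorm_row_continuous : continuous f.
Proof.
pose C := \sum_j f (delta_mx 0 j).
have C0 : 0 <= C by apply: sumr_ge0 => j _; exact: seminorm_ge0.
have fC u : f u <= `|u| * C.
  rewrite {1}(row_sum_delta u) (le_trans (seminorm_sum semif _))// mulr_sumr.
  apply: ler_sum => j _; rewrite semif.2 ler_wpM2r ?seminorm_ge0//.
  exact: mx_coord_le_norm.
move=> v; apply/(@cvgrPdist_le R R^o _ _ (nbhs_filter v) f (f v)) => e e0; apply/nbhs_ballP.
exists (e / (C + 1)) => /=; first by rewrite divr_gt0// ltr_wpDl.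
move=> w; rewrite mx_norm_ball /ball_ /= => /ltW.
rewrite ler_pdivlMr ?ltr_wpDl// => vw.
rewrite (le_trans (seminorm_dist semif _ _))// (le_trans (fC _))//.
by apply: le_trans vw; rewrite ler_wpM2l// lerDl.
Qed.

(** The continuous [f] attains a positive minimum on the compact unit sphere of the maximum norm,
    and [C] is its inverse. *)
Lemma row_norm_equiv : (forall v, f v = 0 -> v = 0) ->
  exists2 C : R, 0 <= C & forall v, `|v| <= C * f v.
Proof.
move=> f0; pose K : set 'rV[R]_n := [set v | `|v| = 1].
(* The sphere is empty when 0 is the only vector; this case is separate. *)
have [[v1 v10]|nv] := pselect (exists v : 'rV[R]_n, v != 0); last first.
  exists 0 => // v; rewrite mul0r.
  have [->|v0] := eqVneq v 0; first by rewrite normr0.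
  by exfalso; apply: nv; exists v.
have unit v : v != 0 -> K (`|v|^-1 *: v).
  by move=> v0; rewrite /K /= normrZ normfV normr_id mulVf// normr_eq0.
have cK : compact K.
  apply: bounded_closed_compact.
    by exists 1; split => // M M1 v /= ->; exact: ltW.
  rewrite (_ : K = (fun v : 'rV[R]_n => `|v|) @^-1` [set 1]) //.
  apply: closed_comp => [v _|]; first exact: norm_continuous.
  exact: closed_eq.
have [c cK1 cmin] := EVT_min_rV (ex_intro _ _ (unit _ v10)) cK
   (continuous_subspaceT seminorm_row_continuous).
have fc0 : 0 < f c.
  rewrite lt_neqAle seminorm_ge0// andbT eq_sym; apply/negP => /eqP/f0 c0.
  by move: cK1; rewrite inE /K /= c0 normr0 => /eqP; rewrite eq_sym oner_eq0.
exists (f c)^-1; first by rewrite invr_ge0 ltW.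
move=> v; have [->|v0] := eqVneq v 0.
  by rewrite normr0 mulr_ge0 ?invr_ge0 ?(ltW fc0)// seminorm_ge0.
have := cmin _ (mem_set (unit _ v0)); rewrite semif.2 normfV normr_id.
by rewrite !(mulrC _^-1) ler_pdivlMr ?normr_gt0// ler_pdivlMr// mulrC.
Qed.

End RowNorm.

Section MatrixNorm.
Context {R : realType} {d : nat} {N : 'M[R]_d -> R}.
Hypothesis normN : is_matrix_norm N.

Lemma matrix_norm_seminorm : seminorm N.
Proof. by case: normN. Qed.

Lemma matrix_norm_coord : exists2 C : R, 0 <= C & forall (A : 'M[R]_d) i j, `|A i j| <= C * N A.
Proof.
have [N0 NZ ND] := normN.
have semi : seminorm (fun v : 'rV[R]_(d * d) => N (vec_mx v)).
  by split => [u v|a u]; rewrite ?linearD ?linearZ ?ND ?NZ.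
have [|C C0 hC] := row_norm_equiv semi.
  by move=> v /N0/(congr1 mxvec); rewrite vec_mxK linear0.
exists C => // A i j; have := hC (mxvec A); rewrite mxvecK; apply: le_trans.
by rewrite -(mxvecE A i j) mx_coord_le_norm.
Qed.

(** Makes the set in [dualnorm] bounded above, so that its [sup] is genuine. *)
Lemma trace_coord_le : exists2 C : R, 0 <= C &
  forall B A : 'M[R]_d, N A <= 1 -> \tr (B^T *m A) <= C * \sum_i \sum_j `|B i j|.
Proof.
have [C C0 hC] := matrix_norm_coord; exists C => // B A NA.
rewrite /mxtrace mulr_sumr.
rewrite (eq_bigr (fun j => \sum_i B i j * A i j)); last first.
  by move=> j _; rewrite mxE; apply: eq_bigr => i _; rewrite mxE.
rewrite exchange_big /=; apply: ler_sum => i _; rewrite mulr_sumr.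
apply: ler_sum => j _; rewrite (le_trans (ler_norm _))// normrM mulrC.
rewrite ler_wpM2r// (le_trans (hC _ _ _))//.
by rewrite ler_piMr.
Qed.

Lemma dualnorm_ub B A : N A <= 1 -> \tr (B^T *m A) <= dualnorm N B.
Proof.
move=> NA; have [C _ hC] := trace_coord_le; apply: ub_le_sup; last by exists A.
by exists (C * \sum_i \sum_j `|B i j|) => _ [A' NA' <-]; exact: hC.
Qed.

Lemma dualnorm_le B c : (forall A, N A <= 1 -> \tr (B^T *m A) <= c) -> dualnorm N B <= c.
Proof.
move=> h; apply: ge_sup; last by move=> _ [A NA <-]; exact: h.
exists (\tr (B^T *m 0)); exists 0 => //=.
by rewrite (seminorm0 matrix_norm_seminorm).
Qed.

Lemma dualnorm_seminorm : seminorm (dualnorm N).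
Proof.
apply: seminormI => [B B'|a B]; apply: dualnorm_le => A NA.
  by rewrite linearD mulmxDl mxtraceD lerD// dualnorm_ub.
rewrite linearZ -scalemxAl mxtraceZ.
have [a0|a0] := leP 0 a; first by rewrite ger0_norm// ler_wpM2l// dualnorm_ub.
rewrite ltr0_norm// -mulrNN ler_wpM2l ?oppr_ge0 ?(ltW a0)//.
rewrite -linearN -mulmxN dualnorm_ub//.
by rewrite (seminormN matrix_norm_seminorm).
Qed.

Lemma trace_le_dualnorm B A : \tr (B^T *m A) <= N A * dualnorm N B.
Proof.
have [N0 NZ ND] := normN.
have [->|A0] := eqVneq A 0.
  by rewrite mulmx0 mxtrace0 (seminorm0 matrix_norm_seminorm) mul0r.
have NA : 0 < N A.
  rewrite lt_neqAle seminorm_ge0 ?andbT; last exact: matrix_norm_seminorm.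
  by rewrite eq_sym; apply/negP => /eqP/N0/eqP; exact/negP.
rewrite -ler_pdivrMl// -mxtraceZ scalemxAr dualnorm_ub//.
by rewrite NZ gtr0_norm ?invr_gt0// mulVf// gt_eqF.
Qed.

(** * The seminorm [H] and the constant [X_*] *)

Context {X : set 'cV[R]_d}.
Hypothesis X0 : X !=set0.
Hypothesis bX : bounded_set X.

(* [H] of the header. *)
Definition dualsup (v : 'cV[R]_d) : R := sup [set dualnorm N (v *m x^T) | x in X].

Lemma bounded_set_coord : exists2 B, 0 <= B & forall x, X x -> forall j, `|x j ord0| <= B.
Proof.
have [M [_ hM]] := bX; exists (`|M| + 1) => [|x Xx j]; first exact: addr_ge0.
rewrite (le_trans (mx_coord_le_norm _ _ _))//; apply: hM => //.
by rewrite ltr_pwDr// ler_norm.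
Qed.

(** Uniformity in [x] is what bounds the sets in [dualsup] and [Xstar]. *)
Lemma dualnorm_outer_le : exists2 C : R, 0 <= C &
  forall v x, X x -> dualnorm N (v *m x^T) <= C * \sum_i `|v i ord0|.
Proof.
have [C C0 hC] := trace_coord_le; have [B B0 hB] := bounded_set_coord.
exists (C * (B *+ d)) => [|v x Xx]; first by rewrite mulr_ge0// mulrn_wge0.
apply: dualnorm_le => A NA; rewrite (le_trans (hC _ _ NA))// -mulrA ler_wpM2l//.
rewrite mulr_sumr; apply: ler_sum => i _.
apply: (@le_trans _ _ (\sum_(j < d) B * `|v i ord0|)); last first.
  by rewrite sumr_const card_ord mulrnAl.
apply: ler_sum => j _; rewrite mxE big_ord1 mxE normrM mulrC ler_wpM2r//.
exact: hB.
Qed.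

Lemma dualsup_ub v x : X x -> dualnorm N (v *m x^T) <= dualsup v.
Proof.
move=> Xx; have [C _ hC] := dualnorm_outer_le; apply: ub_le_sup; last by exists x.
by exists (C * \sum_i `|v i ord0|) => _ [y Xy <-]; exact: hC.
Qed.

Lemma dualsup_le v c : (forall x, X x -> dualnorm N (v *m x^T) <= c) -> dualsup v <= c.
Proof.
case: X0 => x Xx h; apply: ge_sup; last by move=> _ [y Xy <-]; exact: h.
by exists (dualnorm N (v *m x^T)); exists x.
Qed.

Lemma dualsup_seminorm : seminorm dualsup.
Proof.
have sd := dualnorm_seminorm.
apply: seminormI => [u v|a v]; apply: dualsup_le => x Xx.
  by rewrite mulmxDl (le_trans (sd.1 _ _))// lerD// dualsup_ub.
by rewrite -scalemxAl sd.2 ler_wpM2l// dualsup_ub.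
Qed.

(** Duality enters through [v^T A x = trace ((v x^T)^T A)]; the absolute value follows by applying
    the bound to [- A]. *)
Lemma dotv_mul_le A v x : X x -> `|dotv v (A *m x)| <= N A * dualsup v.
Proof.
move=> Xx; have NA := seminorm_ge0 matrix_norm_seminorm A.
have h A' : dotv v (A' *m x) <= N A' * dualsup v.
  have -> : dotv v (A' *m x) = \tr ((v *m x^T)^T *m A').
    rewrite trmx_mul trmxK -mulmxA mxtrace_mulC /dotv -mulmxA.
    by rewrite [RHS]/mxtrace big_ord1.
  rewrite (le_trans (trace_le_dualnorm _ _))// ler_wpM2l ?dualsup_ub//.
  exact: (seminorm_ge0 matrix_norm_seminorm).
rewrite ler_norml h andbT lerNl.
have := h (- A); rewrite (seminormN matrix_norm_seminorm) mulNmx /dotv mulmxN mxE.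
exact.
Qed.

Lemma dualsup_le_Xstar x : X x -> dualsup x <= Xstar N X.
Proof.
move=> Xx; apply: dualsup_le => y Xy.
have [C C0 hC] := dualnorm_outer_le; have [B B0 hB] := bounded_set_coord.
apply: ub_le_sup; last by exists y, x.
exists (C * \sum_(i < d) B) => _ [a [b [Xa [Xb ->]]]].
rewrite (le_trans (hC _ _ Xa))// ler_wpM2l//; apply: ler_sum => i _; exact: hB.
Qed.

End MatrixNorm.

(** * The learning problem *)

(** The vector [u] of the header; both errors and the Rademacher average depend on a data point only
    through it. *)
Definition signed {R : realType} {d : nat} (z : Zdat R d) : 'cV[R]_d := zy z *: zx z.

Lemma measurable_signed_coord (R : realType) d j :
  measurable_fun setT (fun z : Zdat R d => signed z j ord0).
Proof.
rewrite (_ : (fun z => _) = fun z : Zdat R d => z.2 * tnth z.1 j); last first.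
  by apply/funext => z; rewrite /signed /zx /vec !mxE.
apply: measurable_funM; first exact: measurable_snd.
exact: (measurableT_comp (measurable_tnth j) measurable_fst).
Qed.

Lemma measurable_dotv {dO : measure_display} {Om : measurableType dO} (R : realType) d
    (u : Om -> 'cV[R]_d) (a : 'cV[R]_d) :
  (forall j, measurable_fun setT (fun w => u w j ord0)) ->
  measurable_fun setT (fun w => dotv (u w) a).
Proof.
move=> mu; rewrite (_ : (fun w => _) = fun w => \sum_j u w j ord0 * a j ord0).
  by apply: measurable_sum => j; apply: measurable_funM.
by apply/funext => w; rewrite /dotv mxE; apply: eq_bigr => j _; rewrite mxE.
Qed.

Lemma measurable_hinge {dO : measure_display} {Om : measurableType dO} (R : realType) d
    (u : Om -> 'cV[R]_d) (r : R) (a : 'cV[R]_d) :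
  (forall j, measurable_fun setT (fun w => u w j ord0)) ->
  measurable_fun setT (fun w => hinge r a (u w)).
Proof.
move=> mu; apply: measurable_maxr => //.
apply: measurable_funB => //; apply: measurable_funM => //.
exact: measurable_dotv.
Qed.

Lemma KA_signed (R : realType) d (A : 'M[R]_d) (z z' : Zdat R d) :
  zy z * zy z' * KA A (zx z) (zx z') = dotv (signed z) (A *m signed z').
Proof.
rewrite /signed dotvZl -scalemxAr dotvC dotvZl dotvC mulrA; congr (_ * _).
by rewrite /KA /dotv mulmxA.
Qed.

(** By bilinearity of the kernel, the inner sum becomes a pairing with [A] applied to the empirical
    mean. *)
Lemma emp_err_hinge (R : realType) d m r (zs : 'I_m -> Zdat R d) A :
  emp_err r zs A = m%:R^-1 * \sum_i
    hinge r (A *m (m%:R^-1 *: \sum_j signed (zs j))) (signed (zs i)).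
Proof.
congr (_ * _); apply: eq_bigr => i _; congr (pos_part (1 - _)).
rewrite -scalemxAr [dotv _ (_ *: _)]dotvC dotvZl invfM [_^-1 * r^-1]mulrC -mulrA.
congr (_ * (_ * _)); rewrite mulmx_sumr dotv_suml; apply: eq_bigr => j _.
by rewrite KA_signed dotvC.
Qed.

Lemma emp_err_ge0 (R : realType) d m r (zs : 'I_m -> Zdat R d) A :
  0 <= emp_err r zs A.
Proof.
rewrite mulr_ge0 ?invr_ge0// sumr_ge0// => i _.
by rewrite /pos_part le_max lexx orbT.
Qed.

Lemma emp_err0 (R : realType) d m r (zs : 'I_m -> Zdat R d) : (0 < m)%N ->
  emp_err r zs 0 = 1.
Proof.
move=> m0; rewrite emp_err_hinge mul0mx.
rewrite (eq_bigr (fun=> 1)) => [|i _].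
  by rewrite sumr_const card_ord mulVf// pnatr_eq0 -lt0n.
by rewrite /hinge /dotv mulmx0 mxE mulr0 subr0 /pos_part maxEle leNgt ltr01.
Qed.

(** Bookkeeping for [deviation_le_sample_dev]: the four errors [e] come one from [b], one from [F]
    and two from [k]. *)
Lemma deviation_chain {R : realType} {a b c k k' e F G S : R} :
  a <= b + k -> b <= c + e -> `|F - G| <= e -> k <= k' + e + e -> c - G <= S ->
  a - F <= k' + S + 4 * e.
Proof. by rewrite ler_norml => h1 h2 /andP[h3 h4] h5 h6; lra. Qed.

Section Learning.
Context {R : realType} {d m : nat} {X : set 'cV[R]_d} {rho : probability (Zdat R d) R}.
Context {dO : measure_display} {Om : measurableType dO} {P : probability Om R}.
Context {Zs : 'I_m -> Om -> Zdat R d} {r lam : R} {N : 'M[R]_d -> R}.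
Hypothesis m0 : (0 < m)%N.
Hypothesis X0 : X !=set0.
Hypothesis bX : bounded_set X.
Hypothesis supp : {ae rho, forall z, X (zx z) /\ (zy z = 1 \/ zy z = -1)}.
Hypothesis iid : iid_sample rho P Zs.
Hypothesis r0 : 0 < r.
Hypothesis lam0 : 0 < lam.
Hypothesis normN : is_matrix_norm N.

Local Notation H := (@dualsup R d N X).
Local Notation L := (lam^-1).
Local Notation kap := (L / r).

Let semiH : seminorm H := dualsup_seminorm normN X0 bX.

Definition symm_hull : set 'cV[R]_d := [set v | X v \/ X (- v)].

Lemma ae_signed : {ae rho, forall z, symm_hull (signed z)}.
Proof.
apply: filterS supp => z [Xz [yz|yz]]; rewrite /symm_hull /signed yz /=.
  by left; rewrite scale1r.
by right; rewrite scaleN1r opprK.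
Qed.

Lemma symm_hull_ae_sample : {ae P, forall w, forall i, symm_hull (signed (Zs i w))}.
Proof.
have [mZ lawZ _] := iid.
apply: filter_forall => i; have [B [mB B0 sB]] := ae_signed.
exists (Zs i @^-1` B); split; last by move=> w nw; exact: sB.
  by rewrite -[X in measurable X]setTI; exact: mZ.
by rewrite lawZ.
Qed.

Lemma symm_hull_dotv A v u : symm_hull u -> `|dotv v (A *m u)| <= N A * H v.
Proof.
case=> Xu; first exact: dotv_mul_le.
have := dotv_mul_le normN bX A v Xu.
by rewrite mulmxN /dotv mulmxN mxE normrN.
Qed.

Lemma symm_hull_dualsup v : symm_hull v -> H v <= Xstar N X.
Proof.
case=> Xv; first exact: dualsup_le_Xstar.
by rewrite -(seminormN semiH); exact: dualsup_le_Xstar.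
Qed.

Definition mean_signed : 'cV[R]_d := \col_j Rintegral rho setT (fun z => signed z j ord0).

Lemma symm_hull_coord : exists2 B : R, 0 <= B &
  forall v, symm_hull v -> forall j, `|v j ord0| <= B.
Proof.
have [B B0 hB] := bounded_set_coord bX; exists B => // v [Xv|Xv] j; first exact: hB.
by have := hB _ Xv j; rewrite mxE normrN.
Qed.

Lemma integrable_signed_coord j :
  rho.-integrable setT (EFin \o (fun z => signed z j ord0)).
Proof.
have [B B0 hB] := symm_hull_coord.
apply: (ae_bounded_integrable (M := B)) => //; first exact: measurable_signed_coord.
by apply: filterS ae_signed => z /hB.
Qed.

Lemma Rintegral_dotv v :
  Rintegral rho setT (fun z => dotv v (signed z)) = dotv v mean_signed.
Proof.
rewrite /Rintegral.
under eq_integral do rewrite /dotv mxE -sumEFin.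
have intj j : rho.-integrable setT (fun z => (v^T ord0 j * signed z j ord0)%:E).
  under eq_fun do rewrite EFinM.
  by apply: integrableZl => //; exact: integrable_signed_coord.
rewrite integral_sum//.
rewrite (eq_bigr (fun j => (v^T ord0 j * mean_signed j ord0)%:E)).
  by rewrite sumEFin /= /dotv mxE.
move=> j _; under eq_integral do rewrite EFinM.
rewrite integralZl//; last exact: integrable_signed_coord.
rewrite EFinM; congr (_ * _)%E; rewrite mxE /Rintegral fineK//.
by apply: integrable_fin_num => //; exact: integrable_signed_coord.
Qed.

Lemma exp_err_hinge A : exp_err rho r A =
  Rintegral rho setT (fun z => hinge r (A *m mean_signed) (signed z)).
Proof.
rewrite /exp_err; congr Rintegral; apply/funext => z; congr (pos_part (1 - _ * _)).
have adj u v : dotv u (A *m v) = dotv (A^T *m u) v.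
  by rewrite /dotv trmx_mul trmxK mulmxA.
rewrite adj -Rintegral_dotv; congr Rintegral; apply/funext => z'.
by rewrite KA_signed adj.
Qed.

(** The bound holds for [A] applied to almost every [signed z], and integration preserves it. *)
Lemma mean_polar A : N A <= L -> polar H L (A *m mean_signed).
Proof.
move=> NA v.
have -> : dotv v (A *m mean_signed) = dotv (A^T *m v) mean_signed.
  by rewrite /dotv trmx_mul trmxK mulmxA.
rewrite -Rintegral_dotv; apply: ae_bounded_Rintegral.
- rewrite (_ : (fun z => _) = fun z => dotv (signed z) (A^T *m v)).
    by apply: measurable_dotv => j; exact: measurable_signed_coord.
  by apply/funext => z; rewrite dotvC.
- by rewrite mulr_ge0 ?invr_ge0 ?(ltW lam0)// seminorm_ge0.
apply: filterS ae_signed => z Sz.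
rewrite (_ : dotv _ _ = dotv v (A *m signed z)); last first.
  by rewrite /dotv trmx_mul trmxK mulmxA.
by rewrite (le_trans (symm_hull_dotv _ _ Sz))// ler_wpM2r ?seminorm_ge0.
Qed.

(** Each matrix in the Rademacher average is a signed mean times [xt^T], so the supremum over [X] is
    [H] of that mean. *)
Lemma rademacherE : rademacher N X P Zs =
  Rintegral P setT (fun w => (2 ^+ m)%:R^-1 * \sum_(s : {ffun 'I_m -> bool})
    H (\sum_i (m%:R^-1 * rsign (s i)) *: signed (Zs i w))).
Proof.
congr Rintegral; apply/funext => w; congr (_ * _); apply: eq_bigr => s _.
congr sup; congr (_ @` _); apply/funext => x; congr dualnorm.
rewrite mulmx_suml; apply: eq_bigr => i _.
by rewrite /signed -!scalemxAl scalerA.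
Qed.

Lemma rademacher_ge0 : 0 <= rademacher N X P Zs.
Proof.
rewrite rademacherE; apply: Rintegral_ge0 => w _.
by rewrite mulr_ge0 ?invr_ge0// sumr_ge0// => s _; exact: seminorm_ge0.
Qed.

(** * Passage from the sample to the finite alphabet *)

Section Discretized.
Context {K : finType} (cell : Zdat R d -> K) {x : K -> 'cV[R]_d} {eta : R}.
Hypothesis mcell : forall k, measurable (cell @^-1` [set k]).
Hypothesis Sx : forall k, symm_hull (x k).
Hypothesis near_x : forall z, symm_hull (signed z) ->
  forall j, `|(signed z - x (cell z)) j ord0| <= eta.
Hypothesis eta0 : 0 <= eta.

Local Notation p := (cell_mass rho cell).
Local Notation C := (\sum_j H (delta_mx j ord0)).

Definition sample_cell (w : Om) : {ffun 'I_m -> K} := [ffun i => cell (Zs i w)].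

Lemma sample_cell_preimage f : sample_cell @^-1` [set f] =
  \bigcap_(i in [set: 'I_m]) (Zs i @^-1` (cell @^-1` [set f i])).
Proof.
apply/seteqP; split => w /=; first by move=> <- i _ /=; rewrite ffunE.
by move=> h; apply/ffunP => i; rewrite ffunE; exact: (h i I).
Qed.

Lemma measurable_sample_cell f : measurable (sample_cell @^-1` [set f]).
Proof.
have [mZ _ _] := iid.
rewrite sample_cell_preimage; apply: fin_bigcap_measurable => [|i _].
  exact: finite_finset.
by rewrite -[X in measurable X]setTI; exact: mZ.
Qed.

(** Independence enters here: the coded sample has the product law on the alphabet. *)
Lemma sample_cell_mass f : cell_mass P sample_cell f = pweight p f.
Proof.
have [_ lawZ indep] := iid.
rewrite /cell_mass sample_cell_preimage indep//.
rewrite (eq_bigr (fun i => (p (f i))%:E)) => [|i _]; first by rewrite prodEFin.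
by rewrite lawZ// EFin_cell_mass.
Qed.

Lemma near_dualsup z : symm_hull (signed z) -> H (signed z - x (cell z)) <= C * eta.
Proof.
move=> Sz; rewrite mulrC; apply: (seminorm_coord_bound semiH); exact: near_x.
Qed.

Lemma near_mean : H (mean_signed - \sum_k p k *: x k) <= C * eta.
Proof.
rewrite mulrC; apply: (seminorm_coord_bound semiH) => j.
rewrite !mxE summxE (eq_bigr (fun k => p k * x k j ord0)); last first.
  by move=> k _; rewrite mxE.
apply: (Rintegral_cell_approx mcell (g := fun k => x k j ord0)) => //.
  exact: measurable_signed_coord.
by apply: filterS ae_signed => z /near_x/(_ j); rewrite !mxE.
Qed.

(** Replacing every point by its representative moves each signed mean by at most [C eta] in [H],
    uniformly in the signs. *)
Lemma finite_rademacher_le :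
  finite_rademacher p H x m <= rademacher N X P Zs + C * eta.
Proof.
rewrite rademacherE.
pose g (f : {ffun 'I_m -> K}) := (2 ^+ m)%:R^-1 * \sum_(s : {ffun 'I_m -> bool})
  H (\sum_i (m%:R^-1 * rsign (s i)) *: x (f i)).
pose F w := (2 ^+ m)%:R^-1 * \sum_(s : {ffun 'I_m -> bool})
    H (\sum_i (m%:R^-1 * rsign (s i)) *: signed (Zs i w)).
have [mZ _ _] := iid.
have C0 : 0 <= C by apply: sumr_ge0 => j _; exact: seminorm_ge0.
have mF : measurable_fun setT F.
  apply: measurable_funM => //; apply: measurable_sum => s.
  apply: (measurable_seminorm semiH) => j.
  rewrite (_ : (fun w => _) = fun w =>
     \sum_i (m%:R^-1 * rsign (s i)) * signed (Zs i w) j ord0); last first.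
    by apply/funext => w; rewrite summxE; apply: eq_bigr => i _; rewrite mxE.
  apply: measurable_sum => i; apply: measurable_funM => //.
  exact: (measurableT_comp (measurable_signed_coord _) (mZ i)).
have c2 : 0 < (2 ^+ m)%:R :> R by rewrite natrX exprn_gt0.
have mR : 0 < m%:R :> R by rewrite ltr0n.
have : `|Rintegral P setT F - \sum_f cell_mass P sample_cell f * g f| <= C * eta.
  apply: (Rintegral_cell_approx measurable_sample_cell) => //.
    by rewrite mulr_ge0.
  apply: filterS symm_hull_ae_sample => w Sw.
  rewrite /F /g -mulrBr -sumrB normrM gtr0_norm ?invr_gt0//.
  rewrite ler_pdivrMl//.
  have -> : (2 ^+ m)%:R * (C * eta) = \sum_(s : {ffun 'I_m -> bool}) C * eta.
    by rewrite sumr_const card_ffun card_bool card_ord mulr_natl.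
  rewrite (le_trans (ler_norm_sum _ _ _))//; apply: ler_sum => s _.
  rewrite (le_trans (seminorm_dist semiH _ _))// -sumrB.
  rewrite (le_trans (seminorm_sum semiH _))//.
  have -> : C * eta = \sum_(i < m) m%:R^-1 * (C * eta).
    by rewrite sumr_const card_ord -[RHS]mulr_natl mulVKf ?gt_eqF.
  apply: ler_sum => i _; rewrite -scalerBr semiH.2 normrM.
  have -> : `|rsign (s i)| = 1 :> R by rewrite /rsign; case: (s i); rewrite ?normrN1 ?normr1.
  rewrite mulr1 ger0_norm ?invr_ge0// ler_wpM2l ?invr_ge0//.
  by rewrite ffunE; exact: near_dualsup.
have -> : finite_rademacher p H x m = \sum_f cell_mass P sample_cell f * g f.
  by apply: eq_bigr => f _; rewrite sample_cell_mass.
rewrite ler_norml => /andP[]; rewrite -/F; lra.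
Qed.

Lemma deviation_le_sample_dev (A : 'M[R]_d) w : symmx A -> N A <= L ->
  (forall i, symm_hull (signed (Zs i w))) ->
  emp_err r (fun i => Zs i w) A - exp_err rho r A <=
    sample_dev p H x r L (sample_cell w) + 4 * kap * (C * eta).
Proof.
move=> sA NA Sw.
rewrite emp_err_hinge exp_err_hinge.
set ub := m%:R^-1 *: _; set mu := mean_signed; set a := A *m mu.
set t := fun i => x (cell (Zs i w)); set u := fun i => signed (Zs i w).
have La : polar H L a by exact: mean_polar.
have L0 : 0 <= L by rewrite invr_ge0 ltW.
have kap0 : 0 <= kap by rewrite divr_ge0// ltW.
have mR : 0 < m%:R :> R by rewrite ltr0n.
have mi0 : 0 <= m%:R^-1 :> R by rewrite invr_ge0.
have C0 : 0 <= C by apply: sumr_ge0 => j _; exact: seminorm_ge0.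
have avg (F : 'I_m -> R) c : (forall i, F i <= c) -> m%:R^-1 * \sum_i F i <= c.
  move=> Fc; rewrite ler_pdivrMl//.
  rewrite (le_trans (ler_sum _ (fun i _ => Fc i)))// sumr_const card_ord.
  by rewrite mulr_natl.
pose mu' := \sum_k p k *: x k; pose tb := m%:R^-1 *: \sum_i t i.
have ut : H (ub - tb) <= C * eta.
  rewrite -scalerBr -sumrB semiH.2 ger0_norm//.
  apply: le_trans (avg (fun i => H (u i - t i)) _ _); last first.
    by move=> i; exact: near_dualsup.
  by rewrite ler_wpM2l//; exact: seminorm_sum.
(* The direction [A ub] is traded for [a = A mu], which lies in [polar]. *)
have e1 : m%:R^-1 * \sum_i hinge r (A *m ub) (u i) <=
    m%:R^-1 * \sum_i hinge r a (u i) + kap * H (ub - mu).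
  rewrite -lerBlDl -mulrBr -sumrB; apply: avg => i.
  rewrite (le_trans (ler_norm _))// /hinge (le_trans (pos_part_lip _ _))//.
  rewrite (_ : _ - _ = - (r^-1 * dotv (ub - mu) (A *m u i))); last first.
    (* Symmetry of [A] lets the matrix act on [u i], so that [H] measures [ub - mu]. *)
    have sym v : dotv (u i) (A *m v) = dotv v (A *m u i).
      by rewrite dotvC /dotv trmx_mul sA mulmxA.
    by rewrite /a !sym dotvBl; ring.
  rewrite normrN normrM gtr0_norm ?invr_gt0// mulrAC [leRHS]mulrC.
  rewrite ler_wpM2l ?invr_ge0 ?(ltW r0)//.
  rewrite (le_trans (symm_hull_dotv _ _ (Sw i)))//.
  by rewrite ler_wpM2r// seminorm_ge0.
have e2 : m%:R^-1 * \sum_i hinge r a (u i) <=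
    m%:R^-1 * \sum_i hinge r a (t i) + kap * (C * eta).
  rewrite -lerBlDl -mulrBr -sumrB; apply: avg => i.
  apply: le_trans (ler_norm _) _; apply: le_trans (hinge_lip r0 _ _ La) _.
  by apply: (ler_wpM2l kap0); apply: near_dualsup; exact: Sw.
have e3 : `|Rintegral rho setT (fun z => hinge r a (signed z)) -
    \sum_k p k * hinge r a (x k)| <= kap * (C * eta).
  apply: (Rintegral_cell_approx mcell (g := fun k => hinge r a (x k))).
  - by apply: measurable_hinge => j; exact: measurable_signed_coord.
  - exact: mulr_ge0 kap0 (mulr_ge0 C0 eta0).
  apply: filterS ae_signed => z Sz; apply: le_trans (hinge_lip r0 _ _ La) _.
  by apply: (ler_wpM2l kap0); apply: near_dualsup; exact: Sz.
have e4 : kap * H (ub - mu) <= kap * H (tb - mu') + kap * (C * eta) + kap * (C * eta).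
  rewrite -!mulrDr; apply: (ler_wpM2l kap0).
  have -> : ub - mu = (tb - mu') + (ub - tb) + (mu' - mu).
    by rewrite [tb - mu' + _]addrC !subrKA.
  apply: le_trans (semiH.1 _ _) _; apply: lerD.
    by apply: le_trans (semiH.1 _ _) _; apply: lerD; [exact: lexx|exact: ut].
  by rewrite -(seminormN semiH) opprB; exact: near_mean.
have e5 : m%:R^-1 * \sum_i hinge r a (t i) - \sum_k p k * hinge r a (x k) <=
  sup ((fun a => m%:R^-1 * \sum_i hinge r a (t i) - \sum_k p k * hinge r a (x k)) @` polar H L).
  apply: bounded_on_sup_ge La.
  apply: bounded_onD.
    by apply: bounded_onZ; apply: bounded_on_sum => i; exact: hinge_bounded.
  have [M bM] := hinge_comb_bounded H x L r0 p.
  by exists M => b Ab; rewrite normrN bM.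
have -> : sample_dev p H x r L (sample_cell w) = kap * H (tb - mu') +
   sup ((fun a => m%:R^-1 * \sum_i hinge r a (t i) - \sum_k p k * hinge r a (x k)) @` polar H L).
  have E1 : \sum_i x (sample_cell w i) = \sum_i t i.
    by apply: eq_bigr => i _; rewrite ffunE.
  have E2 : (fun b => m%:R^-1 * \sum_i hinge r b (x (sample_cell w i)) -
        \sum_k p k * hinge r b (x k)) =
      (fun b => m%:R^-1 * \sum_i hinge r b (t i) - \sum_k p k * hinge r b (x k)).
    apply/funext => b; congr (_ * _ - _).
    by apply: eq_bigr => i _; rewrite ffunE.
  by rewrite /sample_dev E1 E2.
rewrite -[4 * kap * _]mulrA; exact: deviation_chain e1 e2 e3 e4 e5.
Qed.

End Discretized.

(** Uniform in [A], so that a matrix depending on the sample may be substituted. The error linear in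
    [e] gathers [4 kap C e] from the deviation, as much from the Rademacher average, and the
    enlargement of [X_*]. *)
Lemma approximate_event (delta e : R) : 0 < delta < 1 -> 0 < e ->
  exists E : set Om, [/\ measurable E, ((1 - delta)%:E <= P E)%E &
    forall w, E w -> (forall i, symm_hull (signed (Zs i w))) ->
    forall A, symmx A -> N A <= L ->
      emp_err r (fun i => Zs i w) A - exp_err rho r A <=
        4 * kap * rademacher N X P Zs +
        2 * kap * Xstar N X * Num.sqrt (2 * ln (1 / delta) / m%:R) +
        (8 * kap * (\sum_j H (delta_mx j ord0)) +
         2 * kap * Num.sqrt (2 * ln (1 / delta) / m%:R)) * e].
Proof.
move=> /andP[d0 d1] e0.
have [B B0 hB] := symm_hull_coord.
have S0 : symm_hull !=set0 by have [v Xv] := X0; exists v; left.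
have [K [cell [x [mcell Sx near_x]]]] :=
  finite_discretization (@measurable_signed_coord R d) S0 hB e0.
set C := \sum_j H _; set s := Num.sqrt _.
have L0 : 0 < L by rewrite invr_gt0.
have kap0 : 0 < kap by rewrite divr_gt0.
have mR : 0 < m%:R :> R by rewrite ltr0n.
have Xs0 : 0 <= Xstar N X.
  have [v Xv] := X0; rewrite (le_trans _ (dualsup_le_Xstar normN X0 bX Xv))//.
  exact: seminorm_ge0.
(* The added [e] makes the bound positive, as [finite_tail] requires, even when [Xstar] is 0. *)
pose Xs := Xstar N X + e.
have Xs1 : 0 < Xs by rewrite ltr_wpDl.
have Hx k : H (x k) <= Xs.
  by rewrite (le_trans (symm_hull_dualsup (Sx k)))// lerDl ltW.
pose p := cell_mass rho cell.
have p0 := cell_mass_ge0 rho cell.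
have p1 := cell_mass_sum1 rho mcell.
(* Solves [m e1^2 / (8 (kap Xs)^2) = ln (1 / delta)]. *)
pose e1 := 2 * kap * Xs * s.
have e10 : 0 <= e1.
  exact: mulr_ge0 (mulr_ge0 (mulr_ge0 _ (ltW kap0)) (ltW Xs1)) (sqrtr_ge0 _).
pose bad (f : {ffun 'I_m -> K}) :=
  4 * kap * finite_rademacher p H x m + e1 <= sample_dev p H x r L f.
have mcellm := measurable_sample_cell mcell.
have tail : \sum_(f | bad f) pweight p f <= delta.
  apply: le_trans (finite_tail p0 p1 semiH r0 (ltW L0) Hx m0 kap0 Xs1 e10) _.
  have ln0 : 0 <= ln (1 / delta).
    by rewrite ln_ge0// div1r invf_ge1// ltW.
  rewrite (_ : m%:R * e1 ^+ 2 / _ = ln (1 / delta)); last first.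
    rewrite /e1 exprMn sqr_sqrtr; last by rewrite divr_ge0 ?mulr_ge0.
    by field; rewrite !(gt_eqF lam0, gt_eqF r0, gt_eqF Xs1, gt_eqF mR, gt_eqF d0).
  by rewrite div1r lnV// opprK lnK.
exists [set w | ~~ bad (sample_cell cell w)]; split.
- have mbad : measurable_fun setT ((fun f => (bad f)%:R : R) \o sample_cell cell).
    exact: measurable_cell_comp.
  rewrite (_ : mkset _ = ((fun f => (bad f)%:R : R) \o sample_cell cell) @^-1` [set 0]).
    by rewrite -[X in measurable X]setTI; exact: mbad.
  apply/seteqP; split => w /=; first by move=> /negbTE ->.
  by case: (bad _) => // /eqP; rewrite oner_eq0.
- rewrite (probability_cell P mcellm (fun f => ~~ bad f)) lee_fin.
  have := cell_mass_sum1 P mcellm.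
  rewrite (bigID bad) /= => E.
  have : \sum_(f | bad f) cell_mass P (sample_cell cell) f <= delta.
    apply: le_trans tail; rewrite le_eqVlt; apply/orP; left; apply/eqP.
    by apply: eq_bigr => f _; rewrite sample_cell_mass.
  by lra.
move=> w; rewrite /= -ltNge => gw Sw A sA NA.
have e0' := ltW e0.
apply: le_trans (deviation_le_sample_dev mcell near_x e0' sA NA Sw) _.
have := finite_rademacher_le mcell near_x e0'.
rewrite -/p -/C => /(ler_wpM2l (ltW kap0)) Rle.
move: gw; rewrite /e1 /Xs; lra.
Qed.

(** A point of the limit superior lies in [E k] for arbitrarily large [k], so the error
    [Kc / (k + 1)] can be made as small as desired. *)
Lemma learning_bound (Az : ('I_m -> Zdat R d) -> 'M[R]_d) (delta : R) :
  (forall zs, symmx (Az zs) /\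
     forall A, symmx A ->
       emp_err r zs (Az zs) + lam * N (Az zs) <= emp_err r zs A + lam * N A) ->
  0 < delta < 1 ->
  exists E : set Om, measurable E /\ ((1 - delta)%:E <= P E)%E /\
    forall w, E w ->
      let zs := fun i => Zs i w in
      emp_err r zs (Az zs) - exp_err rho r (Az zs) <=
        4 * kap * rademacher N X P Zs +
        2 * kap * Xstar N X * Num.sqrt (2 * ln (1 / delta) / m%:R).
Proof.
move=> argmin d01.
have NAz zs : N (Az zs) <= L.
  have [_ /(_ 0)] := argmin zs.
  rewrite /symmx trmx0 emp_err0// (seminorm0 (matrix_norm_seminorm normN)) mulr0 addr0.
  move=> /(_ erefl) h; have := emp_err_ge0 r zs (Az zs).
  by rewrite -[L]mul1r ler_pdivlMr// mulrC; lra.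
set Kc := 8 * kap * (\sum_j H (delta_mx j ord0)) +
         2 * kap * Num.sqrt (2 * ln (1 / delta) / m%:R).
have Kc0 : 0 <= Kc.
  have kap0 : 0 <= kap by rewrite divr_ge0 ?invr_ge0// ltW.
  apply: addr_ge0; last exact: mulr_ge0 (mulr_ge0 _ kap0) (sqrtr_ge0 _).
  apply: mulr_ge0 (mulr_ge0 _ kap0) _ => //.
  by apply: sumr_ge0 => j _; exact: seminorm_ge0.
have invS (n : nat) : 0 < n.+1%:R^-1 :> R by rewrite invr_gt0.
have /choice[E hE] n := approximate_event d01 (invS n).
have mE n : measurable (E n) by case: (hE n).
have [B [mB B0 sB]] := symm_hull_ae_sample.
exists (lim_sup_set E `\` B); split; [|split].
- apply: measurableD => //; apply: bigcap_measurable => // n _.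
  exact: bigcup_measurable.
- have Plim : ((1 - delta)%:E <= P (lim_sup_set E))%E.
    (* The tail unions decrease to the limit superior, and each contains some [E n], of probability
       at least [1 - delta]. *)
    have cE := lim_sup_set_cvg P E mE (le_lt_trans (@probability_le1 _ _ _ P _
      (bigcup_measurable (fun k _ => mE k))) (ltry 1)).
    rewrite -(cvg_lim _ cE)//; apply: lime_ge; first by apply/cvg_ex; eexists; exact: cE.
    apply: nearW => n; have [_ PE _] := hE n.
    apply: le_trans PE _; apply: le_measure; rewrite ?inE//.
      exact: bigcup_measurable.
    by move=> w Ew; exists n => /=.
  have mL : measurable (lim_sup_set E).
    by apply: bigcap_measurable => // n _; exact: bigcup_measurable.
  rewrite measureD//; last by rewrite ltey_eq fin_num_measure.
  rewrite [X in (_ <= _ - X)%E](_ : _ = 0%E) ?sube0//.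
  exact: (subset_measure0 (measurableI _ _ mL mB) mB (@subIsetr _ _ _) B0).
- move=> w [Lw nBw] /=.
  have Sw i : symm_hull (signed (Zs i w)).
    by move: i; apply: contrapT => h; apply/nBw/sB.
  have [sA _] := argmin (fun i => Zs i w).
  apply/ler_addgt0Pr => e e0.
  (* Any [k >= n] satisfies [Kc / (k + 1) <= e]. *)
  pose n := Num.truncn (Kc / e).
  have [k /= nk Ekw] := Lw n I.
  have [_ _ hk] := hE k; apply: le_trans (hk w Ekw Sw _ sA (NAz _)) _.
  rewrite -/Kc lerD2l ler_pdivrMr// mulrC -ler_pdivrMr//.
  have /andP[_ /ltW h] := truncn_itv (divr_ge0 Kc0 (ltW e0)).
  by apply: le_trans h _; rewrite ler_nat ltnS.
Qed.

End Learning.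

(** * The generalization bound in its stated form *)

Unset Implicit Arguments.

Theorem theorem1 (R : realType) (d m : nat) (X : set 'cV[R]_d)
    (rho : probability (Zdat R d) R)
    (dO : measure_display) (Omega : measurableType dO) (P : probability Omega R)
    (Zs : 'I_m -> Omega -> Zdat R d)
    (r lam : R) (N : 'M[R]_d -> R) (Az : ('I_m -> Zdat R d) -> 'M[R]_d)
    (delta : R) :
  (0 < m)%N ->
  open X -> connected X -> X !=set0 -> bounded_set X ->
  {ae rho, forall z, X (zx z) /\ (zy z = 1 \/ zy z = -1)} ->
  iid_sample rho P Zs ->
  0 < r -> 0 < lam -> is_matrix_norm N ->
  (forall zs, symmx (Az zs) /\
     forall A, symmx A ->
       emp_err r zs (Az zs) + lam * N (Az zs) <= emp_err r zs A + lam * N A) ->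
  0 < delta < 1 ->
  exists E : set Omega, measurable E /\ ((1 - delta)%:E <= P E)%E /\
    forall w, E w ->
      let zs := fun i => Zs i w in
      emp_err r zs (Az zs) - exp_err rho r (Az zs) <=
        6 * rademacher N X P Zs / (r * lam) +
        2 * Xstar N X / (r * lam) * Num.sqrt (2 * ln (1 / delta) / m%:R).
Proof.
move=> m0 _ _ X0 bX supp iid r0 lam0 normN argmin d01.
have [E [mE [PE hE]]] := learning_bound m0 X0 bX supp iid r0 lam0 normN argmin d01.
exists E; split => //; split => // w Ew.
apply: le_trans (hE w Ew) _.
have rlam0 : 0 < (r * lam)^-1 by rewrite invr_gt0 mulr_gt0.
(* The argument yields the coefficient 4; nonnegativity of the Rademacher average relaxes it to
   6. *)
have : 0 <= rademacher N X P Zs * (r * lam)^-1.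
  by rewrite mulr_ge0 ?(ltW rlam0)//; exact: rademacher_ge0.
by rewrite -[lam^-1 / r]invfM [lam * r]mulrC; lra.
Qed.
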